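(* Let $q\ge1$, $\nu>0$, $f\in L^2(Q_T)$, $u_0\in L^2(\Omega)$, $\Upsilon\in L^2(0,T;H^1(\Omega))$. There is a constant $C>0$ depending only on $q$ (in particular independent of $h,\tau,T,\nu$) such that any $u_{h\tau}\in\mathring{\mathcal V}_{h\tau}^{\mathsf{cont}(q)}$ with $u_{h\tau}(\cdot,0)=\Pi_hu_0$ and $$(\partial_tu_{h\tau},v_{h\tau})_{Q_T}+\nu(\nabla u_{h\tau},\nabla v_{h\tau})_{Q_T}=(f,v_{h\tau})_{Q_T}+\nu(\nabla\Upsilon,\nabla v_{h\tau})_{Q_T}\qquad\forall v_{h\tau}\in\mathring{\mathcal V}_{h\tau}^{\mathsf{disc}(q-1)}$$ satisfies $$\|u_{h\tau}\|_{C^0([0,T];L^2(\Omega))}^2+\nu\|\nabla\Pi_{q-1}^tu_{h\tau}\|_{L^2(Q_T)^d}^2\le C\Big(\|u_0\|_{L^2(\Omega)}^2+\|f\|_{L^1(0,T;L^2(\Omega))}^2+\nu\|\nabla\Upsilon\|_{L^2(Q_T)^d}^2\Big).$$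
   Context: Setting: $\Omega\subset\mathbb R^d$ ($d\in\{1,2,3\}$) is a polytopic domain, $T>0$, $Q_T=\Omega\times(0,T)$. $\mathcal T_h$ is a shape-regular conforming simplicial mesh of $\Omega$ with meshsize $h$. $0=t_0<t_1<\dots<t_N=T$ is an arbitrary partition (no quasi-uniformity), $I_n=(t_{n-1},t_n)$, $\tau_n=t_n-t_{n-1}$, $\tau=\max_n\tau_n$, $Q_n=\Omega\times I_n$. $(\cdot,\cdot)_D$ is the $L^2(D)$ inner product. $p\ge1$ is an integer. Spaces: $\mathring{\mathcal V}_h^p=\{v_h\in H_0^1(\Omega): v_h|_K\in\mathbb P^p(K)\ \forall K\in\mathcal T_h\}$; $\mathring{\mathcal V}_{h\tau}^{\mathsf{disc}(m)}$ is the space of functions whose restriction to each $Q_n$ lies in $\mathbb P^m(I_n)\otimes\mathring{\mathcal V}_h^p$ (no continuity across the $t_n$); $\mathring{\mathcal V}_{h\tau}^{\mathsf{cont}(m)}$ is the subspace of those that are continuous in time on $[0,T]$. Projections: $\Pi_h:L^2(\Omega)\to\mathring{\mathcal V}_h^p$ is the $L^2(\Omega)$-orthogonal projection. $\Pi_{q-1}^t$ is the $L^2$-orthogonal projection in time, on each $I_n$, onto polynomials in time of degree at most $q-1$. *)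

(* Defs.v *)
From HB Require Import structures.
From mathcomp Require Import all_boot all_order all_algebra.
From mathcomp Require Import all_classical all_reals all_analysis.
From mathcomp.multinomials Require Import (canonicals, coercions) mpoly.

Set Implicit Arguments.
Unset Strict Implicit.
Unset Printing Implicit Defensive.
Import Order.TTheory GRing.Theory Num.Theory.
Import numFieldNormedType.Exports.

Local Open Scope classical_set_scope.
Local Open Scope ring_scope.

Definition rV_display : measure_display.
Proof. exact: default_measure_display. Qed.

Section measurable_rV.
Context {R : realType}.
Variable n : nat.

(* Borel sigma-algebra of R^n, generated by the coordinate maps. *)
Let coors : 'I_n -> 'rV[R]_n -> measurableTypeR R := fun i x => x ord0 i.

Let rV_set0 : g_sigma_preimage coors set0.
Proof. exact: sigma_algebra0. Qed.

Let rV_setC A : g_sigma_preimage coors A -> g_sigma_preimage coors (~` A).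
Proof. exact: sigma_algebraC. Qed.

Let rV_bigcup (F : (set 'rV[R]_n)^nat) : (forall i, g_sigma_preimage coors (F i)) ->
  g_sigma_preimage coors (\bigcup_i (F i)).
Proof. exact: sigma_algebra_bigcup. Qed.

HB.instance Definition _ := @isMeasurable.Build rV_display
  'rV[R]_n (g_sigma_preimage coors) rV_set0 rV_setC rV_bigcup.

End measurable_rV.

Section coordinates.
Context {R : realType}.

Lemma measurable_fun_rVP d (T : measurableType d) n (f : T -> 'rV[R]_n) :
  (forall i, measurable_fun [set: T] (fun x => f x ord0 i)) ->
  measurable_fun [set: T] f.
Proof.
move=> mf.
pose coors (i : 'I_n) (x : 'rV[R]_n) : measurableTypeR R := x ord0 i.
suff : g_sigma_preimage (fun i => coors i \o f) `<=` measurable.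
  rewrite g_sigma_preimage_comp => H _ A mA.
  by apply: H; exists A.
apply: smallest_sub; first exact: sigma_algebra_measurable.
case: n => [|n] in f mf coors *; first by rewrite big_ord0.
rewrite -bigcup_mkord_ord; apply: bigcup_sub => i Ii.
by move=> A [B mB <-]; exact: mf.
Qed.

Lemma measurable_coord n (i : 'I_n) :
  measurable_fun [set: 'rV[R]_n] (fun x => x ord0 i).
Proof.
move=> _ Y mY; rewrite setTI; apply: sub_sigma_algebra => /=.
rewrite -bigcup_seq/=; exists i => /=; first by rewrite mem_index_enum.
by exists Y => //; rewrite setTI.
Qed.

Definition row_cons n (z : measurableTypeR R * 'rV[R]_n) : 'rV[R]_n.+1 :=
  row_mx (z.1 : R)%:M z.2.

Definition row_uncons n (v : 'rV[R]_n.+1) : measurableTypeR R * 'rV[R]_n :=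
  (v ord0 ord0, @rsubmx R 1 1 n v).

Lemma row_consK n : cancel (@row_cons n) (@row_uncons n).
Proof.
case=> x y; rewrite /row_uncons /row_cons; congr pair; last exact: row_mxKr.
transitivity ((row_mx (x : R)%:M y : 'rV[R]_(1 + n)) ord0 (lshift n ord0)).
  by congr (fun_of_matrix _ _ _); apply/val_inj.
by rewrite row_mxEl mxE eqxx mulr1n.
Qed.

Lemma measurable_row_cons n : measurable_fun setT (@row_cons n).
Proof.
apply: measurable_fun_rVP => i.
case: (@split_ordP 1 n i) => j ->.
  rewrite (_ : (fun _ => _) = fst); first exact: measurable_fst.
  apply/funext => z; apply: etrans (row_mxEl _ _ _ _) _.
  by rewrite mxE !ord1 mulr1n.
rewrite (_ : (fun _ => _) = (fun y : 'rV[R]_n => y ord0 j) \o snd).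
  exact: (measurableT_comp (measurable_coord j) measurable_snd).
by apply/funext => z; exact: row_mxEr.
Qed.

Lemma measurable_row_uncons n : measurable_fun setT (@row_uncons n).
Proof.
apply: measurable_fun_pair; first exact: measurable_coord.
apply: measurable_fun_rVP => i.
rewrite (_ : (fun _ => _) = fun v : 'rV[R]_n.+1 => v ord0 (rshift 1 i)).
  exact: measurable_coord.
by apply/funext => v; rewrite mxE.
Qed.

End coordinates.

(* Lebesgue measure on R^n, the n-fold product of the one on R. *)
Fixpoint leb (R : realType) (n : nat) : set 'rV[R]_n -> \bar R :=
  match n with
  | 0 => \d_(0 : 'rV[R]_0)
  | m.+1 => pushforward ((@lebesgue_measure R) \x @leb R m)%E (@row_cons R m)
  end.
Arguments leb {R} n.

Section leb_succ.
Context {R : realType} (n : nat) (m : {sigma_finite_measure set 'rV[R]_n -> \bar R}).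

Local Notation mu := (@lebesgue_measure R \x m)%E.
Let push := pushforward mu (@row_cons R n).
Let mf := @measurable_row_cons R n.

Let push0 : push set0 = 0%E. Proof. exact: measure0. Qed.

Let push_ge0 A : (0 <= push A)%E. Proof. exact: measure_ge0. Qed.

Let push_sigma_additive : semi_sigma_additive push.
Proof. exact: measure_semi_sigma_additive. Qed.

#[local] HB.instance Definition _ := isMeasure.Build _ _ _ push
  push0 push_ge0 push_sigma_additive.

Let push_sigma_finite : sigma_finite setT push.
Proof.
have /sigma_finiteP[F [TF ndF Foo]] := sigma_finiteT (@lebesgue_measure R).
have /sigma_finiteP[G [TG ndG Goo]] := sigma_finiteT m.
exists (fun k => @row_uncons R n @^-1` (F k `*` G k)).
  rewrite -preimage_bigcup (_ : \bigcup_k _ = setT) ?preimage_setT//.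
  rewrite -subTset => -[x y] _.
  have [i _ Fix] : (\bigcup_i F i) x by rewrite -TF.
  have [j _ Gjy] : (\bigcup_j G j) y by rewrite -TG.
  exists (maxn i j) => //; split=> /=.
    by move: x Fix; exact/subsetPset/ndF/leq_maxl.
  by move: y Gjy; exact/subsetPset/ndG/leq_maxr.
move=> k; have [mF Fk] := Foo k; have [mG Gk] := Goo k; split.
  rewrite -[X in measurable X]setTI; apply: measurable_row_uncons => //.
  exact: measurableX.
rewrite /push /pushforward -comp_preimage.
rewrite (_ : _ \o _ = id); last by apply/funext => z /=; rewrite row_consK.
by rewrite preimage_id product_measure1E// lte_mul_pinfty// ge0_fin_numE.
Qed.

#[local] HB.instance Definition _ := Measure_isSigmaFinite.Build _ _ _ push
  push_sigma_finite.

Definition leb_succ : {sigma_finite_measure set 'rV[R]_n.+1 -> \bar R} := push.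

End leb_succ.

Section leb_measure.
Context {R : realType} (n : nat).

Lemma leb_sigma_finite_measure :
  exists m : {sigma_finite_measure set 'rV[R]_n -> \bar R}, leb n = m.
Proof.
elim: n => [|k [m IH]]; first by exists (\d_(0 : 'rV[R]_0)).
by exists (leb_succ m); rewrite /= IH.
Qed.

Let leb0 : @leb R n set0 = 0%E.
Proof. by have [m ->] := leb_sigma_finite_measure; exact: measure0. Qed.

Let leb_ge0 A : (0 <= @leb R n A)%E.
Proof. by have [m ->] := leb_sigma_finite_measure; exact: measure_ge0. Qed.

Let leb_sigma_additive : semi_sigma_additive (@leb R n).
Proof.
by have [m ->] := leb_sigma_finite_measure; exact: measure_semi_sigma_additive.
Qed.

HB.instance Definition _ := isMeasure.Build _ _ _ (@leb R n)
  leb0 leb_ge0 leb_sigma_additive.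

Let leb_sigma_finite : sigma_finite setT (@leb R n).
Proof. by have [m ->] := leb_sigma_finite_measure; exact: sigma_finiteT. Qed.

HB.instance Definition _ := Measure_isSigmaFinite.Build _ _ _ (@leb R n)
  leb_sigma_finite.

End leb_measure.

Notation leb_xt d := (leb d \x lebesgue_measure)%E.

Section L2.
Context {disp : measure_display} {X : measurableType disp} {R : realType}.
Variables (mu : {measure set X -> \bar R}) (D : set X).

Definition L2 : set (X -> R) := [set f | f \_ D \in Lfun mu 2%:E].

Definition L2norm (f : X -> R) : \bar R := 'N[mu]_2%:E[EFin \o (f \_ D)]%E.

Definition L2ip (f g : X -> R) : R := \int[mu]_(x in D) (f x * g x).

Definition is_L2proj (V : set (X -> R)) (f w : X -> R) : Prop :=
  V w /\ forall v, V v -> L2ip w v = L2ip f v.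

End L2.

Section euclidean.
Context {R : realType} {d : nat}.
Implicit Types (x y : 'rV[R]_d) (A : set 'rV[R]_d).

Definition dot x y : R := \sum_i x ord0 i * y ord0 i.

(* The library norm on 'rV[R]_d is the sup norm. *)
Definition enorm x : R := Num.sqrt (dot x x).

Definition hull A : set 'rV[R]_d := smallest (@convex_set R 'rV[R]_d) A.

Definition diam A : R := sup [set enorm (z.1 - z.2) | z in A `*` A].

Definition inradius A : R :=
  sup [set r | 0 <= r /\ exists c, [set x | enorm (x - c) <= r] `<=` A].

Definition polytopic_domain (Omega : set 'rV[R]_d) : Prop :=
  [/\ Omega !=set0, connected Omega &
      exists Ps : seq (seq 'rV[R]_d),
        Omega = interior (\bigcup_(P in [set` Ps]) hull [set` P])].

(* A simplex of R^d is given by the d.+1 rows of a matrix, its vertices. *)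
Definition vertices (K : 'M[R]_(d.+1, d)) : set 'rV[R]_d :=
  [set row i K | i in setT].

Definition simplex (K : 'M[R]_(d.+1, d)) : set 'rV[R]_d := hull (vertices K).

Definition affinely_independent (K : 'M[R]_(d.+1, d)) : bool :=
  row_free (row_mx K (const_mx 1 : 'cV[R]_d.+1)).

(* Two elements meet in the (possibly empty) face spanned by their common
   vertices. *)
Definition conforming_mesh (Omega : set 'rV[R]_d) (Th : seq 'M[R]_(d.+1, d)) :=
  [/\ forall K, K \in Th -> affinely_independent K,
      closure Omega = \bigcup_(K in [set` Th]) simplex K &
      forall K K', K \in Th -> K' \in Th ->
        simplex K `&` simplex K' = hull (vertices K `&` vertices K')].

Definition shape_regular (gamma : R) (Th : seq 'M[R]_(d.+1, d)) : Prop :=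
  forall K, K \in Th -> diam (simplex K) <= gamma * inradius (simplex K).

End euclidean.

Section sobolev.
Context {R : realType} {d : nat}.
Variable Omega : set 'rV[R]_d.
Implicit Types (phi v : 'rV[R]_d -> R) (g : 'rV[R]_d -> 'rV[R]_d).

Definition partial (i : 'I_d) phi : 'rV[R]_d -> R := 'D_(delta_mx ord0 i) phi.

Definition grad phi : 'rV[R]_d -> 'rV[R]_d := fun x => \row_i partial i phi x.

Fixpoint Ck (k : nat) phi : Prop :=
  if k is k'.+1
  then (forall x, differentiable phi x) /\ (forall i, Ck k' (partial i phi))
  else continuous phi.

Definition test_function phi : Prop :=
  [/\ forall k, Ck k phi,
      compact (closure [set x | phi x != 0]) &
      closure [set x | phi x != 0] `<=` Omega].

(* v lies in H^1(Omega) exactly when such a g exists. *)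
Definition is_weak_grad v g : Prop :=
  [/\ L2 (leb d) Omega v,
      forall i, L2 (leb d) Omega (fun x => g x ord0 i) &
      forall phi, test_function phi -> forall i,
        L2ip (leb d) Omega v (partial i phi) =
        - L2ip (leb d) Omega (fun x => g x ord0 i) phi].

(* Closure of the test functions in H^1(Omega). *)
Definition H10 v : Prop :=
  exists2 g, is_weak_grad v g &
    forall e : R, 0 < e -> exists phi,
      [/\ test_function phi,
          (L2norm (leb d) Omega (v \- phi)%R < e%:E)%E &
          (L2norm (leb d) Omega (fun x => enorm (g x - grad phi x)) < e%:E)%E].

(* Functions on the mesh are represented by their continuous representatives,
   which coincide with a polynomial up to the boundary of each element. *)
Definition Vh (Th : seq 'M[R]_(d.+1, d)) (p : nat) : set ('rV[R]_d -> R) :=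
  [set v | H10 v /\
    forall K, K \in Th ->
      exists2 P : mpoly.mpoly d R, (mpoly.msize P <= p.+1)%N &
        forall x, simplex K x -> Omega x ->
          v x = mpoly.meval (fun i => x ord0 i) P].

End sobolev.

Section space_time.
Context {R : realType} {d : nat}.
Variables (Omega : set 'rV[R]_d) (T : R).
Implicit Types (u v w : 'rV[R]_d * R -> R) (G : 'rV[R]_d * R -> 'rV[R]_d).

Definition QT : set ('rV[R]_d * R) := Omega `*` `]0, T[.

Definition is_xgrad u G : Prop :=
  (forall i, L2 (leb_xt d) QT (fun z => G z ord0 i)) /\
  {ae lebesgue_measure, forall t : R, 0 < t < T ->
    is_weak_grad Omega (fun x => u (x, t)) (fun x => G (x, t))}.

(* L^2(0,T;H^1(Omega)): Bochner-measurable functions are identified with the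
   jointly measurable ones having a jointly measurable spatial gradient. *)
Definition L2H1 : set ('rV[R]_d * R -> R) :=
  [set u | L2 (leb_xt d) QT u /\ exists G, is_xgrad u G].

(* The spatial weak gradient, unique up to null sets; it is 0 if there is none. *)
Definition xgrad u : 'rV[R]_d * R -> 'rV[R]_d :=
  xget (fun=> 0) [set G | is_xgrad u G].

Definition dt u : 'rV[R]_d * R -> R :=
  fun z => derive1 (fun s : R => u (z.1, s)) z.2.

Definition xgrad_ip u v : R :=
  \int[leb_xt d]_(z in QT) dot (xgrad u z) (xgrad v z).

Definition xgrad_norm u : \bar R :=
  L2norm (leb_xt d) QT (fun z => enorm (xgrad u z)).

Definition norm_L1L2 u : \bar R :=
  (\int[lebesgue_measure]_(t in `]0%R, T[)
     L2norm (leb d) Omega (fun x => u (x, t)))%E.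

Definition norm_C0L2 u : \bar R :=
  ereal_sup [set L2norm (leb d) Omega (fun x => u (x, t)) | t in `[0, T]].

Section time_steps.
Variables (N : nat) (t : nat -> R).

Definition time_partition : Prop :=
  [/\ t 0 = 0, t N = T & forall n, (n < N)%N -> t n < t n.+1].

(* The slices t = t_n are negligible, but the values there must not spoil
   measurability. *)
Definition Vdisc (V : set ('rV[R]_d -> R)) (m : nat) : set ('rV[R]_d * R -> R) :=
  [set u | measurable_fun QT u /\
    forall n, (n < N)%N ->
      exists2 w : nat -> 'rV[R]_d -> R, (forall k, V (w k)) &
        forall x s, Omega x -> t n < s < t n.+1 ->
          u (x, s) = \sum_(k < m.+1) s ^+ k * w k x].

Definition Vcont (V : set ('rV[R]_d -> R)) (m : nat) : set ('rV[R]_d * R -> R) :=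
  [set u | Vdisc V m u /\
    forall x, Omega x -> {within `[0, T], continuous (fun s => u (x, s))}].

(* L^2(a,b)-orthogonal projection onto polynomials of degree at most m. *)
Definition poly_proj (a b : R) (m : nat) (g : R -> R) : {poly R} :=
  xget 0 [set P : {poly R} | (size P <= m.+1)%N /\
    forall Q : {poly R}, (size Q <= m.+1)%N ->
      L2ip lebesgue_measure `]a, b[ (horner P) (horner Q) =
      L2ip lebesgue_measure `]a, b[ g (horner Q)].

Definition time_proj (m : nat) u : 'rV[R]_d * R -> R := fun z =>
  \sum_(n < N | t n < z.2 < t n.+1)
    (poly_proj (t n) (t n.+1) m (fun s => u (z.1, s))).[z.2].

End time_steps.

End space_time.

(* Main.v *)
Require Import Defs.
From HB Require Import structures.
From mathcomp Require Import all_boot all_order all_algebra.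
From mathcomp Require Import all_classical all_reals all_analysis.
From mathcomp Require Import measurable_realfun ring lra.
From mathcomp.multinomials Require Import (canonicals, coercions) mpoly.

Set Implicit Arguments.
Unset Strict Implicit.
Unset Printing Implicit Defensive.
Import Order.TTheory GRing.Theory Num.Theory.
Import numFieldNormedType.Exports.

Local Open Scope classical_set_scope.
Local Open Scope ring_scope.

(* Let [Pi] be the L^2 projection in time onto degree [q-1], and test the scheme on each slab with
   an operator in time applied to [u]. Testing with [Pi u] everywhere telescopes to the energy at
   the nodes and controls [grad (Pi u)]. To control [u] inside a slab, test on that slab with
   [Pi (w Pi u)] instead, where the weight [w] decreases affinely from 1 to 0, and with [0] after
   it: since [s u' - q u] has degree less than [q] in time, the error [u - Pi u] contributes with a
   good sign, and the time term bounds the mean of [|u|^2] over the slab. An inverse estimate for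
   polynomials in time turns the largest such mean into a bound of [|u|] at all times, with a
   constant depending only on [q], and this closes the estimate against [f] in L^1(L^2). Spatial
   gradients being defined only up to null sets, gradients computed coefficientwise are identified
   with them through the fundamental lemma of the calculus of variations. *)

Lemma quadratic_ge0_discriminant_le (R : realType) (a b c : R) :
  (forall x, 0 <= a * x ^+ 2 + 2 * b * x + c) -> b ^+ 2 <= a * c.
Proof.
move=> abc_ge0; pose p : {poly R} := Poly [:: c; 2 * b; a].
have : p`_1 ^+ 2 - 4 * p`_2 * p`_0 <= 0.
  rewrite deg_le2_poly_ge0 ?size_Poly// => x.
  by have := abc_ge0 x; rewrite horner_Poly/=; lra.
rewrite !coef_Poly/=; nra.
Qed.

Section poly_integral.
Context {R : realType}.
Implicit Types (a b : R) (p q : {poly R}).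
Local Notation mu := (@lebesgue_measure R).

Definition pint a b p : R := \int[mu]_(s in `]a, b[) p.[s].

Lemma integrable_horner (l r : bool) a b p :
  mu.-integrable [set` Interval (BSide l a) (BSide r b)] (EFin \o horner p).
Proof.
apply: (@integrableS _ _ _ mu `[a, b]) => //.
  by apply: subset_itv; rewrite bnd_simp.
apply: continuous_compact_integrable; first exact: segment_compact.
by apply: continuous_subspaceT => x; exact: continuous_horner.
Qed.

Lemma pint_is_linear a b : linear_for *%R (pint a b).
Proof.
move=> c p q; rewrite /pint.
under eq_Rintegral do rewrite hornerD hornerZ.
have ip := integrable_horner false true a b p.
rewrite RintegralD ?RintegralZl//; last exact: integrable_horner.
exact: (integrableZl _ c ip).
Qed.

HB.instance Definition _ a b :=
  GRing.isLinear.Build R {poly R} R *%R (pint a b) (pint_is_linear a b).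

Lemma pintZ a b c p : pint a b (c *: p) = c * pint a b p.
Proof. exact: linearZ. Qed.

Lemma pint_ge0 a b p : (forall s, a < s < b -> 0 <= p.[s]) -> 0 <= pint a b p.
Proof. by move=> p0; apply: Rintegral_ge0 => s /=; rewrite in_itv/=; exact: p0. Qed.

Lemma le_pint a b p q : (forall s, a < s < b -> p.[s] <= q.[s]) ->
  pint a b p <= pint a b q.
Proof.
move=> pq; rewrite -subr_ge0 -linearB; apply: pint_ge0 => s sab.
by rewrite hornerD hornerN subr_ge0 pq.
Qed.

Lemma pint_sqr_ge0 a b p : 0 <= pint a b (p * p).
Proof. by apply: pint_ge0 => s _; rewrite hornerM -expr2 sqr_ge0. Qed.

Lemma pint_deriv a b p : a < b -> pint a b p^`() = p.[b] - p.[a].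
Proof.
move=> ab; rewrite /pint Rintegral_itv_bndo_bndc ?Rintegral_itv_obnd_cbnd//; last 2 first.
- exact: integrable_horner.
- exact: integrable_horner.
have cp q : continuous (horner q) by move=> x; exact: continuous_horner.
rewrite /Rintegral (@continuous_FTC2 _ _ (horner p))//.
- exact: continuous_subspaceT.
- split; first by move=> x _; exact: derivable_horner.
  + by apply: cvg_at_right_filter; exact: cp.
  + by apply: cvg_at_left_filter; exact: cp.
- by move=> x _; rewrite derive1E; apply: derive_val; exact: is_derive_poly.
Qed.

Lemma poly_antideriv p : exists P : {poly R}, P^`() = p.
Proof.
exists (\poly_(i < (size p).+1) (p`_i.-1 / i%:R)); apply/polyP => i.
rewrite coef_deriv coef_poly ltnS /=.
case: ltnP => ip; first by rewrite -[LHS]mulr_natr divfK// pnatr_eq0.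
by rewrite mul0rn nth_default.
Qed.

Lemma poly_itv_eq0 a b p : a < b -> (forall s, a < s < b -> root p s) -> p = 0.
Proof.
move=> ab p0; have ba0 : 0 < b - a by rewrite subr_gt0.
apply: (@roots_geq_poly_eq0 _ _ [seq a + (b - a) / k.+2%:R | k <- iota 0 (size p)]).
- apply/allP => _ /mapP[k _ ->]; apply: p0.
  by rewrite ltrDl divr_gt0//= -ltrBrDl ltr_pdivrMr// ltr_pMr// ltr1n.
- rewrite map_inj_uniq ?iota_uniq// => i j /addrI.
  by move=> /(mulfI (lt0r_neq0 ba0))/invr_inj/eqP; rewrite eqr_nat => /eqP[].
- by rewrite size_map size_iota.
Qed.

Lemma pint_sqr_eq0 a b p : a < b -> pint a b (p * p) = 0 -> p = 0.
Proof.
move=> ab p0; have [P PE] := poly_antideriv (p * p).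
have P_nondecreasing x y : x < y -> P.[x] <= P.[y].
  by move=> xy; rewrite -subr_ge0 -pint_deriv// PE pint_sqr_ge0.
have PbE : P.[b] = P.[a] by apply/eqP; rewrite -subr_eq0 -pint_deriv// PE p0.
have /subr0_eq P_cst : P - P.[a]%:P = 0.
  apply: (poly_itv_eq0 ab) => x /andP[ax xb]; rewrite rootE !hornerE subr_eq0.
  by rewrite eq_le -{1}PbE !P_nondecreasing.
by apply/eqP; rewrite -[_ == _]orbb -mulf_eq0 -PE P_cst derivC.
Qed.

Lemma pint_affine a b p : a < b ->
  pint a b p = (b - a) * pint 0 1 (p \Po ((b - a) *: 'X + a%:P)).
Proof.
move=> ab; have [P <-] := poly_antideriv p.
have := deriv_comp P ((b - a) *: 'X + a%:P).
rewrite derivD derivZ derivX derivC addr0 alg_polyC mulrC mul_polyC => PE.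
by rewrite -pintZ -PE !pint_deriv// !horner_comp !hornerE subrK.
Qed.

Lemma pint_cauchy_schwarz a b p q :
  pint a b (p * q) ^+ 2 <= pint a b (p * p) * pint a b (q * q).
Proof.
rewrite -(mulrC (pint a b (q * q))); apply: quadratic_ge0_discriminant_le => x.
have := pint_sqr_ge0 a b (x *: q + p).
rewrite (_ : _ * _ = x *: (x *: (q * q) + 2 *: (p * q)) + p * p); last first.
  by rewrite -!mul_polyC; ring.
by rewrite !linearD/= !pintZ; lra.
Qed.

End poly_integral.

Section poly_projection.
Context {R : realType}.
Variables (a b : R) (ab : a < b) (m : nat).
Implicit Types p q r : {poly R}.

Lemma poly_sum_coef p : (size p <= m)%N -> p = \sum_(j < m) p`_j *: 'X^j.
Proof.
move=> pm; rewrite -poly_def; apply/polyP => i; rewrite coef_poly.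
by case: ltnP => // mi; rewrite nth_default// (leq_trans pm).
Qed.

Lemma coef_linear_sum (M : {linear {poly R} -> {poly R}}) k p : (size p <= m)%N ->
  (M p)`_k = \sum_(j < m) (M 'X^j)`_k * p`_j.
Proof.
move=> pm; rewrite {1}(poly_sum_coef pm) linear_sum coef_sum.
by apply: eq_bigr => j _; rewrite linearZ coefZ mulrC.
Qed.

Lemma pint_mul_sum_coef p q : (size q <= m)%N ->
  pint a b (p * q) = \sum_(j < m) q`_j * pint a b (p * 'X^j).
Proof.
move=> qm; rewrite {1}(poly_sum_coef qm) mulr_sumr linear_sum/=.
by apply: eq_bigr => j _; rewrite -scalerAr pintZ.
Qed.

Definition gram : 'M[R]_m := \matrix_(i, j) pint a b ('X^i * 'X^j).

Lemma mul_rV_gram (v : 'rV_m) j : (v *m gram) ord0 j = pint a b (rVpoly v * 'X^j).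
Proof.
rewrite mxE [rVpoly v]poly_sum_coef ?size_poly// mulr_suml linear_sum/=.
by apply: eq_bigr => i _; rewrite mxE coef_rVpoly_ord -scalerAl pintZ.
Qed.

Lemma gram_unit : gram \in unitmx.
Proof.
rewrite -row_free_unit -kermx_eq0; apply/eqP/row_matrixP => k.
set v := row k _; rewrite row0 -[v]rVpolyK.
suff -> : rVpoly v = 0 by rewrite linear0.
apply: (pint_sqr_eq0 ab); rewrite pint_mul_sum_coef ?size_poly// big1// => j _.
by rewrite -mul_rV_gram -row_mul mulmx_ker !mxE mulr0.
Qed.

Definition pproj p : {poly R} :=
  rVpoly ((\row_(j < m) pint a b (p * 'X^j)) *m invmx gram).

Lemma size_pproj p : (size (pproj p) <= m)%N.
Proof. exact: size_poly. Qed.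

Lemma pproj_is_linear : linear pproj.
Proof.
move=> c p q; rewrite /pproj -linearZ -linearD scalemxAl -mulmxDl.
congr (rVpoly (_ *m _)).
by apply/rowP => j; rewrite !mxE mulrDl linearD/= -scalerAl pintZ.
Qed.

HB.instance Definition _ := GRing.isLinear.Build R {poly R} {poly R} _ pproj
  pproj_is_linear.

Lemma pint_pproj p q : (size q <= m)%N -> pint a b (pproj p * q) = pint a b (p * q).
Proof.
move=> qm; rewrite !pint_mul_sum_coef//; apply: eq_bigr => j _.
by rewrite -mul_rV_gram mulmxKV ?gram_unit// mxE.
Qed.

Lemma pint_pproj_orthogonal p q : (size q <= m)%N -> pint a b ((p - pproj p) * q) = 0.
Proof. by move=> qm; rewrite mulrBl linearB/= pint_pproj// subrr. Qed.

Lemma pproj_unique p r : (size r <= m)%N ->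
  (forall q, (size q <= m)%N -> pint a b (r * q) = pint a b (p * q)) ->
  r = pproj p.
Proof.
move=> rm rP; apply/eqP; rewrite -subr_eq0; apply/eqP/(pint_sqr_eq0 ab).
have sm : (size (r - pproj p)%R <= m)%N.
  by rewrite (leq_trans (size_polyD _ _))// geq_max rm size_polyN size_pproj.
by rewrite mulrBl linearB/= rP// pint_pproj// subrr.
Qed.

Lemma pint_mul_pproj p : pint a b (p * pproj p) = pint a b (pproj p * pproj p).
Proof. by rewrite pint_pproj ?size_pproj. Qed.

Lemma pint_sqr_pproj_residual p :
  pint a b ((p - pproj p) * p) = pint a b ((p - pproj p) * (p - pproj p)).
Proof.
by rewrite mulrBr [RHS]linearB/= (pint_pproj_orthogonal _ (size_pproj _)) subr0.
Qed.

Lemma pint_sqr_pproj p : pint a b (pproj p * pproj p) <= pint a b (p * p).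
Proof.
rewrite -pint_mul_pproj -subr_ge0 -linearB/= -mulrBr mulrC pint_sqr_pproj_residual.
exact: pint_sqr_ge0.
Qed.

Lemma coef_pint_dual k : exists r, forall p, (size p <= m)%N -> p`_k = pint a b (p * r).
Proof.
have [km|mk] := ltnP k m; last first.
  by exists 0 => p pm; rewrite mulr0 linear0 nth_default// (leq_trans pm).
pose r : {poly R} := rVpoly (delta_mx ord0 (Ordinal km) *m invmx gram).
have rX (j : 'I_m) : pint a b (r * 'X^j) = (j == Ordinal km)%:R.
  by rewrite -mul_rV_gram mulmxKV ?gram_unit// mxE eqxx.
exists r => p pm; rewrite mulrC pint_mul_sum_coef// (bigD1 (Ordinal km))//=.
rewrite big1 => [|j /negbTE jk]; last by rewrite rX jk mulr0.
by rewrite (rX (Ordinal km)) eqxx mulr1 addr0.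
Qed.

End poly_projection.

Section inverse_estimate.
Context {R : realType}.
Implicit Types (a b K : R) (p : {poly R}).

Definition inverse_constant (m : nat) K : Prop := forall a b p s,
  a < b -> (size p <= m)%N -> a <= s <= b -> (b - a) * p.[s] ^+ 2 <= K * pint a b (p * p).

Lemma coef_sqr_le_pint m : exists2 K, 0 < K &
  forall p k, (size p <= m)%N -> p`_k ^+ 2 <= K * pint 0 1 (p * p).
Proof.
have /choice[r rP] := coef_pint_dual (ltr01 : 0 < 1 :> R) m.
have sqr_r_ge0 k : 0 <= pint 0 1 (r k * r k) by exact: pint_sqr_ge0.
exists (1 + \sum_(k < m) pint 0 1 (r k * r k)).
  by rewrite ltr_pwDl// sumr_ge0.
move=> p k pm; have [km|mk] := ltnP k m; last first.
  rewrite nth_default ?(leq_trans pm)// expr0n/= mulr_ge0 ?pint_sqr_ge0//.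
  by rewrite addr_ge0// sumr_ge0.
rewrite (rP _ _ pm) (le_trans (pint_cauchy_schwarz _ _ _ _))// mulrC.
rewrite ler_wpM2r ?pint_sqr_ge0// (bigD1 (Ordinal km))//= addrCA lerDl.
by rewrite addr_ge0// sumr_ge0.
Qed.

Lemma inverse_estimate01 m : exists2 K, 0 < K & forall p y,
  (size p <= m)%N -> 0 <= y <= 1 -> p.[y] ^+ 2 <= K * pint 0 1 (p * p).
Proof.
have [K K0 KP] := coef_sqr_le_pint m.
exists (K * (m%:R ^+ 2 + 1)); first by rewrite mulr_gt0// ltr_wpDl// sqr_ge0.
move=> p y pm /andP[y0 y1]; set I := pint 0 1 (p * p).
have KI0 : 0 <= K * I by rewrite mulr_ge0 ?pint_sqr_ge0// ltW.
have py_le : `|p.[y]| <= m%:R * Num.sqrt (K * I).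
  rewrite (horner_coef_wide _ pm) (le_trans (ler_norm_sum _ _ _))//.
  rewrite -[m in leRHS]card_ord mulr_natl -sumr_const ler_sum// => i _.
  rewrite normrM -[leRHS]mulr1 ler_pM//; first by rewrite -sqrtr_sqr ler_wsqrtr// KP.
  by rewrite normrX exprn_ile1// ger0_norm.
rewrite -real_normK ?num_real//.
apply: le_trans (lerXn2r 2 (normr_ge0 _) (le_trans (normr_ge0 _) py_le) py_le) _.
rewrite exprMn sqr_sqrtr// mulrCA mulrA ler_wpM2r ?pint_sqr_ge0//.
by rewrite ler_pM2l// lerDl.
Qed.

Lemma inverse_estimate m : exists2 K, 0 < K & inverse_constant m K.
Proof.
have [K K0 KP] := inverse_estimate01 m; exists K => // a b p s ab pm /andP[as_ sb].
have ba0 : 0 < b - a by rewrite subr_gt0.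
pose affine : {poly R} := (b - a) *: 'X + a%:P; pose y := (s - a) / (b - a).
have size_affine : size affine = 2.
  have sX : size ((b - a) *: 'X : {poly R}) = 2 by rewrite size_scale ?gt_eqF// size_polyX.
  by rewrite size_polyDl sX// (leq_ltn_trans (size_polyC_leq1 _)).
have y01 : 0 <= y <= 1.
  by rewrite /y ler_pdivlMr// mul0r subr_ge0 as_ ler_pdivrMr// mul1r lerD2r.
have -> : p.[s] = (p \Po affine).[y].
  by rewrite horner_comp hornerD hornerZ hornerX hornerC mulrC divfK ?gt_eqF// subrK.
rewrite pint_affine// -/affine comp_polyM [leRHS]mulrCA ler_pM2l//.
by apply: KP => //; rewrite size_comp_poly2.
Qed.

End inverse_estimate.

Section weighted_projection.
Context {R : realType}.
Variables (a b : R) (ab : a < b) (m : nat).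
Implicit Types p q : {poly R}.

Local Notation P := (pproj a b m).

Definition weight : {poly R} := (b - a)^-1 *: (b%:P - 'X).

Definition wproj p : {poly R} := P (weight * P p).

Lemma wproj_is_linear : linear wproj.
Proof. by move=> c p q; rewrite /wproj linearP mulrDr -scalerAr linearP. Qed.

HB.instance Definition _ := GRing.isLinear.Build R {poly R} {poly R} _ wproj
  wproj_is_linear.

Lemma weight_ge0_le1 s : a < s < b -> 0 <= weight.[s] <= 1.
Proof.
move=> /andP[as_ sb]; rewrite /weight !hornerE mulrC.
apply/andP; split; first by rewrite divr_ge0 ?subr_ge0// ltW.
by rewrite ler_pdivrMr ?subr_gt0// mul1r lerD2l lerN2 ltW.
Qed.

Lemma size_deriv_leq p : (size p <= m.+1)%N -> (size p^`() <= m)%N.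
Proof. by move=> pm; rewrite (leq_trans (size_poly _ _))// -subn1 leq_subLR. Qed.

Lemma size_euler_leq p : (size p <= m.+1)%N ->
  (size ('X * p^`() - m%:R *: p)%R <= m)%N.
Proof.
move=> pm; have coef_gt j : (m < j)%N -> p`_j = 0.
  by move=> mj; rewrite nth_default// (leq_trans pm).
apply/leq_sizeP => j; rewrite leq_eqVlt coefB coefXM coefZ coef_deriv => /predU1P[<-|mj].
  by case: m => [|k]; rewrite ?mul0r ?subrr//= -[X in X - _]mulr_natl subrr.
by case: j mj => //= j mj; rewrite coef_gt// mul0rn mulr0 subrr.
Qed.

Lemma pint_sqr_deriv p : pint a b (p * p^`()) = (p.[b] ^+ 2 - p.[a] ^+ 2) / 2.
Proof.
have := pint_deriv (p * p) ab; rewrite derivM linearD/= (mulrC p^`()) !hornerM -!expr2.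
by move=> <-; field.
Qed.

Lemma pint_deriv_pproj p : (size p <= m.+1)%N ->
  pint a b (p^`() * P p) = (p.[b] ^+ 2 - p.[a] ^+ 2) / 2.
Proof.
by move=> pm; rewrite mulrC pint_pproj ?size_deriv_leq// pint_sqr_deriv.
Qed.

Lemma pint_weight_mul_deriv p :
  pint a b (weight * (p * p^`())) = pint a b (p * p) / (b - a) / 2 - p.[a] ^+ 2 / 2.
Proof.
have ba0 : b - a != 0 by rewrite subr_eq0 gt_eqF.
have weightE s : weight.[s] = (b - a)^-1 * (b - s) by rewrite /weight !hornerE.
have dweight : weight^`() = - ((b - a)^-1)%:P.
  by rewrite /weight derivZ derivB derivC derivX sub0r scalerN alg_polyC.
have := pint_deriv (weight * (p * p)) ab.
rewrite !hornerM !weightE subrr mulr0 mul0r sub0r mulVf// mul1r -expr2.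
rewrite derivM dweight derivM (_ : _ + _ =
    2 *: (weight * (p * p^`())) - (b - a)^-1 *: (p * p)); last first.
  by rewrite -!mul_polyC; ring.
by rewrite linearB/= !pintZ => /eqP; rewrite subr_eq => /eqP; lra.
Qed.

(* [s p' - m p] has degree less than [m], so it does not see [p - P p]. *)
Lemma pint_pproj_residual_mulX_deriv p : (size p <= m.+1)%N ->
  pint a b ((p - P p) * ('X * p^`())) = m%:R * pint a b ((p - P p) * (p - P p)).
Proof.
move=> pm; have := pint_pproj_orthogonal ab p (size_euler_leq pm).
by rewrite mulrBr linearB/= -scalerAr pintZ pint_sqr_pproj_residual// => /subr0_eq.
Qed.

Lemma pint_deriv_wproj_ge p : (size p <= m.+1)%N ->
  pint a b (p * p) / (b - a) / 2 - p.[a] ^+ 2 / 2 <= pint a b (p^`() * wproj p).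
Proof.
move=> pm; have p'm := size_deriv_leq pm; set r := p - P p.
have -> : p^`() * wproj p = wproj p * p^`() by rewrite mulrC.
rewrite pint_pproj// (_ : weight * P p * p^`() =
    weight * (p * p^`()) + (b - a)^-1 *: (r * ('X * p^`()) - b *: (r * p^`()))); last first.
  by rewrite /r /weight -!mul_polyC; ring.
rewrite linearD/= pint_weight_mul_deriv lerDl pintZ linearB/= pintZ.
rewrite pint_pproj_residual_mulX_deriv// (pint_pproj_orthogonal ab p p'm) mulr0 subr0.
by rewrite mulr_ge0 ?invr_ge0 ?subr_ge0 ?(ltW ab)// mulr_ge0// pint_sqr_ge0.
Qed.

Lemma pint_sqr_wproj_le p : pint a b (wproj p * wproj p) <= pint a b (p * wproj p).
Proof.
have -> : pint a b (p * wproj p) = pint a b (weight * P p * P p).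
  by rewrite -(pint_pproj ab p (size_pproj _ _ _ _)) mulrC pint_pproj ?size_pproj.
apply: (le_trans (pint_sqr_pproj ab _ _)); apply: le_pint => s /weight_ge0_le1/andP[w0 w1].
by rewrite !hornerM mulrACA -[leRHS]mulrA ler_wpM2r ?ler_piMl// -expr2 sqr_ge0.
Qed.

Lemma pint_sqr_wproj_le_sqr p : pint a b (wproj p * wproj p) <= pint a b (p * p).
Proof.
apply: (le_trans (pint_sqr_pproj ab _ _)); apply: le_trans (pint_sqr_pproj ab m p).
apply: le_pint => s /weight_ge0_le1/andP[w0 w1]; rewrite !hornerM mulrACA.
by rewrite ler_piMl ?mulr_ile1// -expr2 sqr_ge0.
Qed.

End weighted_projection.

Section L2_functions.
Context d (X : measurableType d) (R : realType) (mu : {measure set X -> \bar R}).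
Implicit Types f g h k : X -> R.

Lemma Lfun2P f : f \in Lfun mu 2%:E <->
  measurable_fun setT f /\ mu.-integrable setT (EFin \o (fun x => f x ^+ 2)).
Proof.
split=> [f2|[mf /integrableP[_ f2]]].
  split; last exact: Lfun2_integrable_sqr.
  by case/andP: f2; rewrite inE.
apply/andP; split; rewrite inE//= /finite_norm unlock poweR_lty//.
apply: le_lt_trans f2; apply: ge0_le_integral => //.
- by move=> x _; exact: poweR_ge0.
- apply/measurable_EFinP; apply: (measurableT_comp (measurable_powR _)).
  exact: measurableT_comp.
- apply/measurable_EFinP; apply: measurableT_comp => //; exact: measurable_funX.
- by move=> x _; rewrite /= lee_fin normrX powR_mulrn.
Qed.

Lemma Lfun2_measurable f : f \in Lfun mu 2%:E -> measurable_fun setT f.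
Proof. by case/Lfun2P. Qed.

Lemma Lfun2_0 : (fun=> 0) \in Lfun mu (2%:E : \bar R).
Proof. by have [] := Lfun_submod_closed mu (lee1n 2). Qed.

Lemma Lfun2_axpy c f g : f \in Lfun mu 2%:E -> g \in Lfun mu 2%:E ->
  (fun x => c * f x + g x) \in Lfun mu 2%:E.
Proof. by have [_ +] := Lfun_submod_closed mu (lee1n 2); exact. Qed.

Lemma Lfun2Z c f : f \in Lfun mu 2%:E -> (fun x => c * f x) \in Lfun mu 2%:E.
Proof.
move=> f2; have := Lfun2_axpy c f2 Lfun2_0.
by under eq_fun do rewrite addr0.
Qed.

Lemma Lfun2_sum I (r : seq I) (F : I -> X -> R) : (forall i, F i \in Lfun mu 2%:E) ->
  (fun x => \sum_(i <- r) F i x) \in Lfun mu 2%:E.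
Proof.
move=> F2; elim: r => [|i r IH]; first by under eq_fun do rewrite big_nil; exact: Lfun2_0.
by under eq_fun do rewrite big_cons -[F _ _]mul1r; exact: Lfun2_axpy.
Qed.

Lemma Lfun2_bounded f (A : set X) (M : R) : measurable A -> (mu A < +oo)%E ->
  measurable_fun setT f -> (forall x, `|f x| <= M * \1_A x) -> f \in Lfun mu 2%:E.
Proof.
move=> mA Aoo mf fM.
have indicA : mu.-integrable setT (EFin \o \1_A).
  apply/integrableP; split; first by apply/measurable_EFinP; exact: measurable_indic.
  under eq_integral do rewrite /= ger0_norm//.
  by rewrite integral_indic ?setIT.
apply/Lfun2P; split => //.
apply: (@le_integrable _ _ _ _ _ _ _ (EFin \o (fun x => M ^+ 2 * \1_A x))) => //.
- by apply/measurable_EFinP; exact: measurable_funX.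
- move=> x _ /=; rewrite lee_fin ger0_norm ?sqr_ge0// ger0_norm ?(mulr_ge0 (sqr_ge0 M))//.
  have := fM x; rewrite -[f x ^+ 2]real_normK ?num_real// indicE.
  case: (_ \in _); rewrite ?mulr1 ?mulr0 => fxM; first by rewrite lerXn2r// nnegrE (le_trans _ fxM).
  by rewrite (le_anti (introT andP (conj fxM (normr_ge0 _)))) expr0n.
- exact: (integrableZl measurableT (M ^+ 2) indicA).
Qed.

Lemma Lfun2_mul_integrable f g : f \in Lfun mu 2%:E -> g \in Lfun mu 2%:E ->
  mu.-integrable setT (fun x => (f x * g x)%:E).
Proof. by move=> f2 g2; apply/Lfun1_integrable; exact: Lfun2_mul_Lfun1. Qed.

Lemma Rintegral_sum I (r : seq I) (F : I -> X -> R) :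
  (forall i, mu.-integrable setT (EFin \o F i)) ->
  \int[mu]_x (\sum_(i <- r) F i x) = \sum_(i <- r) \int[mu]_x F i x.
Proof.
move=> Fi; rewrite /Rintegral sum_fine => [|i _]; last first.
  by apply: integrable_fin_num => //; exact: Fi.
by rewrite -integral_sum//; congr fine; apply: eq_integral => x _; rewrite sumEFin.
Qed.

Lemma Rintegral_mul_young f g : f \in Lfun mu 2%:E -> g \in Lfun mu 2%:E ->
  \int[mu]_x (f x * g x) <= (\int[mu]_x (f x ^+ 2) + \int[mu]_x (g x ^+ 2)) / 2.
Proof.
move=> f2 g2.
have if2 := Lfun2_integrable_sqr f2; have ig2 := Lfun2_integrable_sqr g2.
have i2 : mu.-integrable setT (EFin \o (fun x => f x ^+ 2 + g x ^+ 2)).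
  exact: (integrableD measurableT if2 ig2).
rewrite -RintegralD// -RintegralZr//.
apply: le_Rintegral => //; first exact: Lfun2_mul_integrable.
  exact: (integrableZr measurableT _ i2).
move=> x _; have := sqr_ge0 (f x - g x); rewrite sqrrB; lra.
Qed.

Lemma Lnorm2_sqr f : ('N[mu]_2%:E[EFin \o f] ^+ 2 = \int[mu]_x (f x ^+ 2)%:E)%E.
Proof.
have -> : ('N[mu]_2%:E[EFin \o f] ^+ 2 = 'N[mu]_2%:E[EFin \o f] `^ 2)%E.
  have := Lnorm_ge0 mu 2%:E (EFin \o f).
  move: ('N[mu]_2%:E[EFin \o f])%E => [r| |]//=.
    by rewrite lee_fin => r0; rewrite powR_mulrn.
  by rewrite pnatr_eq0/= mulyy.
rewrite powR_Lnorm//; apply: eq_integral => x _ /=.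
by rewrite powR_mulrn// real_normK ?num_real.
Qed.

Lemma Lfun2_Lnorm f : f \in Lfun mu 2%:E ->
  'N[mu]_2%:E[EFin \o f]%E = (Num.sqrt (\int[mu]_x (f x ^+ 2)))%:E.
Proof.
move=> f2.
have norm_fin : ('N[mu]_2%:E[EFin \o f] \is a fin_num)%E.
  by rewrite ge0_fin_numE ?Lnorm_ge0//; case/andP: f2 => _; rewrite inE.
rewrite -(fineK norm_fin); congr EFin.
have := Lnorm2_sqr f; rewrite -(fineK norm_fin) -EFin_expe /Rintegral => <- /=.
by rewrite sqrtr_sqr ger0_norm// fine_ge0// Lnorm_ge0.
Qed.

Lemma le_Lnorm (r : R) f g : 0 <= r -> measurable_fun setT f -> measurable_fun setT g ->
  (forall x, `|f x| <= `|g x|) ->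
  ('N[mu]_r%:E[EFin \o f] <= 'N[mu]_r%:E[EFin \o g])%E.
Proof.
move=> r0 mf mg fg; have mpow (h : X -> R) : measurable_fun setT h ->
    measurable_fun setT (fun x => (`|h x| `^ r)%:E).
  move=> mh; apply/measurable_EFinP; apply: (measurableT_comp (measurable_powR r)).
  exact: measurableT_comp.
rewrite unlock; apply: gt0_ler_poweR; rewrite ?invr_ge0 ?in_itv/= ?leey ?integral_ge0//.
apply: ge0_le_integral => //; [exact: mpow mf|exact: mpow mg|] => x _.
by rewrite lee_fin ge0_ler_powR// nnegrE.
Qed.

Lemma Lnorm2_axpy_le (c : R) f g h :
  f \in Lfun mu 2%:E -> g \in Lfun mu 2%:E -> measurable_fun setT h ->
  (forall x, `|h x| <= `|c| * `|f x| + `|g x|) ->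
  ('N[mu]_2%:E[EFin \o h] <=
     `|c|%:E * 'N[mu]_2%:E[EFin \o f] + 'N[mu]_2%:E[EFin \o g])%E.
Proof.
move=> f2 g2 mh hfg; have cf2 := Lfun2Z c f2.
have mnorm k : k \in Lfun mu 2%:E -> measurable_fun setT (fun x => `|k x|).
  by move=> k2; apply: measurableT_comp => //; exact: Lfun2_measurable k2.
have norm_le k : k \in Lfun mu 2%:E ->
    ('N[mu]_2%:E[EFin \o (fun x => `|k x|%R)] <= 'N[mu]_2%:E[EFin \o k])%E.
  move=> k2; apply: le_Lnorm => // [||x]; last by rewrite normr_id.
    exact: mnorm.
  exact: Lfun2_measurable k2.
pose s x : R := `|c * f x| + `|g x|.
apply: (@le_trans _ _ 'N[mu]_2%:E[EFin \o s]%E).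
  apply: le_Lnorm => //; first exact: measurable_funD (mnorm _ cf2) (mnorm _ g2).
  by move=> x; rewrite /s normrM [leRHS]ger0_norm ?normrM// addr_ge0// mulr_ge0.
apply: (le_trans (minkowski_EFin _ (mnorm _ cf2) (mnorm _ g2) _)); first by rewrite ler1n.
by rewrite -(LnormZ (Lfun_Sub (lee1n 2) f2) c); apply: leeD; exact: norm_le.
Qed.

End L2_functions.

Lemma product_measure_ysection_eq0 d1 d2 (X : measurableType d1) (Y : measurableType d2)
    (R : realType) (mu : {sigma_finite_measure set X -> \bar R})
    (nu : {sigma_finite_measure set Y -> \bar R}) (A : set (X * Y)) :
  measurable A -> {ae nu, forall y, mu (ysection A y) = 0%E} -> (mu \x nu)%E A = 0%E.
Proof.
move=> mA A0; transitivity ((mu \x^ nu)%E A).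
  by apply: product_measure_unique => // B C mB mC; rewrite /= product_measure2E.
rewrite -[RHS](integral0 nu setT); apply: ae_eq_integral => //.
  exact: measurable_fun_ysection.
by apply: filterS A0 => y Ay _.
Qed.

Section L2_on_a_set.
Context d (X : measurableType d) (R : realType) (mu : {measure set X -> \bar R}).
Variable D : set X.
Implicit Types f g h : X -> R.

Lemma restrict_axpy c f g :
  (fun x => c * f x + g x) \_ D = fun x => c * (f \_ D) x + (g \_ D) x.
Proof. by apply/funext => x; rewrite !patchE; case: ifP => // _; rewrite mulr0 addr0. Qed.

Lemma eq_restrict f g : (forall x, D x -> f x = g x) -> f \_ D = g \_ D.
Proof.
by move=> fg; apply/funext => x; rewrite !patchE; case: ifPn => // /set_mem; exact: fg.
Qed.

Lemma L2_axpy c f g : L2 mu D f -> L2 mu D g -> L2 mu D (fun x => c * f x + g x).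
Proof. by move=> f2 g2; rewrite /L2/= restrict_axpy; exact: Lfun2_axpy. Qed.

Lemma L2B f g : L2 mu D f -> L2 mu D g -> L2 mu D (fun x => f x - g x).
Proof. by move=> f2 g2; under eq_fun do rewrite addrC -mulN1r; exact: L2_axpy. Qed.

Lemma L2ip_restrictl f g : L2ip mu D f g = \int[mu]_x ((f \_ D) x * g x).
Proof.
rewrite /L2ip Rintegral_mkcond; apply: eq_Rintegral => x _.
by rewrite !patchE; case: ifP => // _; rewrite mul0r.
Qed.

Lemma L2ip_restrict f g : L2ip mu D f g = \int[mu]_x ((f \_ D) x * (g \_ D) x).
Proof.
rewrite L2ip_restrictl; apply: eq_Rintegral => x _.
by rewrite !patchE; case: ifP => // _; rewrite !mul0r.
Qed.

Lemma L2ip_axpyl c f g h : L2 mu D f -> L2 mu D g -> h \in Lfun mu 2%:E ->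
  L2ip mu D (fun x => c * f x + g x) h = c * L2ip mu D f h + L2ip mu D g h.
Proof.
move=> f2 g2 h2; rewrite !L2ip_restrictl restrict_axpy.
have ifh := Lfun2_mul_integrable f2 h2; have igh := Lfun2_mul_integrable g2 h2.
under eq_Rintegral do rewrite mulrDl -mulrA.
rewrite RintegralD//; first by rewrite RintegralZl.
exact: (integrableZl measurableT _ ifh).
Qed.

Lemma L2norm_sqr f : L2 mu D f ->
  (L2norm mu D f ^+ 2 = (\int[mu]_x ((f \_ D) x ^+ 2))%:E)%E.
Proof.
move=> f2; rewrite /L2norm Lnorm2_sqr /Rintegral fineK//.
by apply: integrable_fin_num => //; exact: Lfun2_integrable_sqr.
Qed.

Lemma L2norm_axpy_le (c : R) f g h : L2 mu D f -> L2 mu D g -> L2 mu D h ->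
  (forall x, `|h x| <= `|c| * `|f x| + `|g x|) ->
  (L2norm mu D h <= `|c|%:E * L2norm mu D f + L2norm mu D g)%E.
Proof.
move=> f2 g2 h2 hfg; apply: Lnorm2_axpy_le => //; first exact: Lfun2_measurable h2.
by move=> x; rewrite !patchE; case: ifP => // _; rewrite normr0 mulr0 addr0.
Qed.

Lemma L2proj_norm_le (V : set (X -> R)) f w : L2 mu D f -> L2 mu D w ->
  is_L2proj mu D V f w ->
  \int[mu]_x ((w \_ D) x ^+ 2) <= \int[mu]_x ((f \_ D) x ^+ 2).
Proof.
move=> f2 w2 [Vw /(_ _ Vw)]; rewrite !L2ip_restrict.
under eq_Rintegral do rewrite -expr2.
by have := Rintegral_mul_young f2 w2; lra.
Qed.

End L2_on_a_set.

Section L2_vector_fields.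
Context d (X : measurableType d) (R : realType) (mu : {measure set X -> \bar R}).
Variables (D : set X) (n : nat).
Implicit Types (x y : 'rV[R]_n) (g h : X -> 'rV[R]_n).

Lemma sqr_enorm x : enorm x ^+ 2 = dot x x.
Proof. by rewrite sqr_sqrtr// sumr_ge0// => i _; rewrite -expr2 sqr_ge0. Qed.

Lemma normr_enorm x : `|enorm x| = enorm x.
Proof. by rewrite ger0_norm// sqrtr_ge0. Qed.

Lemma dot_axpy_sqr (c : R) x y :
  dot (c *: x + y) (c *: x + y) = c ^+ 2 * dot x x + 2 * c * dot x y + dot y y.
Proof.
rewrite /dot !mulr_sumr -!big_split; apply: eq_bigr => i _ /=.
by rewrite !mxE; ring.
Qed.

Lemma dot_cauchy_schwarz x y : dot x y ^+ 2 <= dot x x * dot y y.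
Proof.
apply: quadratic_ge0_discriminant_le => c; have := sqr_ge0 (enorm (c *: x + y)).
by rewrite sqr_enorm dot_axpy_sqr; lra.
Qed.

Lemma enorm_axpy_le (c : R) x y : enorm (c *: x + y) <= `|c| * enorm x + enorm y.
Proof.
have x0 : 0 <= enorm x by exact: sqrtr_ge0.
have y0 : 0 <= enorm y by exact: sqrtr_ge0.
rewrite -(@ler_pXn2r _ 2) ?nnegrE ?sqrtr_ge0 ?addr_ge0 ?mulr_ge0//.
rewrite sqr_enorm dot_axpy_sqr sqrrD exprMn real_normK ?num_real// !sqr_enorm lerD2r lerD2l.
have : `|dot x y| <= enorm x * enorm y.
  rewrite -(@ler_pXn2r _ 2) ?nnegrE ?mulr_ge0// real_normK ?num_real//.
  by rewrite exprMn !sqr_enorm dot_cauchy_schwarz.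
move=> /(ler_wpM2l (normr_ge0 c)); rewrite -normrM.
by move=> /(le_trans (ler_norm _)); rewrite mulr2n; lra.
Qed.

Definition L2_field g := forall i, L2 mu D (fun z => g z ord0 i).

Definition field_ip g h : R := \int[mu]_(z in D) dot (g z) (h z).

Lemma field_ip_sum g h : L2_field g -> L2_field h ->
  field_ip g h = \sum_i L2ip mu D (fun z => g z ord0 i) (fun z => h z ord0 i).
Proof.
move=> g2 h2; under eq_bigr do rewrite L2ip_restrict.
rewrite -Rintegral_sum => [|i]; last exact: Lfun2_mul_integrable (g2 i) (h2 i).
rewrite /field_ip Rintegral_mkcond; apply: eq_Rintegral => z _; rewrite patchE.
case: ifPn => zD; first by apply: eq_bigr => i _; rewrite !patchE zD.
by rewrite big1// => i _; rewrite !patchE (negbTE zD) mul0r.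
Qed.

Lemma field_ip_ge0 g : 0 <= field_ip g g.
Proof. by apply: Rintegral_ge0 => z _; rewrite -sqr_enorm sqr_ge0. Qed.

Lemma field_ip_le g h : L2_field g -> L2_field h ->
  field_ip g h <= (field_ip g g + field_ip h h) / 2.
Proof.
move=> g2 h2; rewrite !field_ip_sum// -big_split mulr_suml ler_sum// => i _ /=.
rewrite !L2ip_restrict; under [X in _ <= (X + _) / 2]eq_Rintegral do rewrite -expr2.
under [X in _ <= (_ + X) / 2]eq_Rintegral do rewrite -expr2.
exact: Rintegral_mul_young (g2 i) (h2 i).
Qed.

Lemma eq_ae_field_ip g g' h h' : L2_field g -> L2_field g' -> L2_field h -> L2_field h' ->
  {ae mu, forall z, D z -> g z = g' z} -> {ae mu, forall z, D z -> h z = h' z} ->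
  field_ip g h = field_ip g' h'.
Proof.
move=> g2 g'2 h2 h'2 gg' hh'; rewrite !field_ip_sum//; apply: eq_bigr => i _.
rewrite !L2ip_restrict; congr fine; apply: ae_eq_integral => //.
- exact: measurable_int (Lfun2_mul_integrable (g2 i) (h2 i)).
- exact: measurable_int (Lfun2_mul_integrable (g'2 i) (h'2 i)).
apply: filterS2 gg' hh' => z gz hz _; congr EFin; rewrite !patchE.
by case: ifPn => // /set_mem zD; rewrite gz// hz.
Qed.

Lemma restrict_enormE g : (fun z => enorm (g z)) \_ D =
  fun z => Num.sqrt (\sum_i ((fun z => g z ord0 i) \_ D) z ^+ 2).
Proof.
apply/funext => z; rewrite patchE; case: ifPn => zD.
  by congr Num.sqrt; apply: eq_bigr => i _; rewrite patchE zD expr2.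
by rewrite big1 ?sqrtr0// => i _; rewrite patchE (negbTE zD) expr0n.
Qed.

Lemma L2_enorm g : L2_field g -> L2 mu D (fun z => enorm (g z)).
Proof.
move=> g2; rewrite /L2/= restrict_enormE; apply/Lfun2P; split.
  apply: (measurableT_comp (continuous_measurable_fun (@sqrt_continuous R))).
  by apply: measurable_sum => i; apply: measurable_funX; exact: Lfun2_measurable (g2 i).
rewrite (_ : EFin \o _ = fun z => \sum_i (((fun z => g z ord0 i) \_ D) z ^+ 2)%:E)%E.
  by apply: integrable_sum => // i _; exact: Lfun2_integrable_sqr (g2 i).
apply/funext => z /=; rewrite sumEFin sqr_sqrtr// sumr_ge0// => i _; exact: sqr_ge0.
Qed.

Lemma L2_field_axpy (c : R) g h : L2_field g -> L2_field h ->
  L2_field (fun z => c *: g z + h z).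
Proof.
by move=> g2 h2 i; under eq_fun do rewrite !mxE; exact: L2_axpy (g2 i) (h2 i).
Qed.

Lemma L2_fieldB g h : L2_field g -> L2_field h -> L2_field (fun z => g z - h z).
Proof. by move=> g2 h2 i; under eq_fun do rewrite !mxE; exact: L2B (g2 i) (h2 i). Qed.

Lemma L2norm_enorm_axpy_le (c : R) g h : L2_field g -> L2_field h ->
  (L2norm mu D (fun z => enorm (c *: g z + h z)) <=
     `|c|%:E * L2norm mu D (fun z => enorm (g z)) + L2norm mu D (fun z => enorm (h z)))%E.
Proof.
move=> g2 h2; apply: L2norm_axpy_le; [exact: L2_enorm|exact: L2_enorm| |] => [|z].
  by apply: L2_enorm; exact: L2_field_axpy.
by rewrite !normr_enorm enorm_axpy_le.
Qed.

Lemma L2norm_enorm_sqr g : L2_field g ->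
  (L2norm mu D (fun z => enorm (g z)) ^+ 2 = (field_ip g g)%:E)%E.
Proof.
move=> g2; rewrite (L2norm_sqr (L2_enorm g2)) /field_ip [in RHS]Rintegral_mkcond; congr EFin.
apply: eq_Rintegral => z _; rewrite !patchE; case: ifP => _; first exact: sqr_enorm.
by rewrite expr0n.
Qed.

End L2_vector_fields.

Section partition.
Context {R : realType} (N : nat) (t : nat -> R).

Definition nodes : set R := [set t n | n in `I_N.+1].

Lemma measurable_nodes : measurable (nodes : set (measurableTypeR R)).
Proof.
apply: (countable_measurable (fun x => @measurable_set1 _ _)).
by apply: finite_set_countable; exact: finite_image.
Qed.

Lemma lebesgue_measure_nodes : @lebesgue_measure R nodes = 0%E.
Proof.
by apply: countable_lebesgue_measure0; apply: finite_set_countable; exact: finite_image.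
Qed.

Lemma slab_index s : t 0 < s < t N -> ~ nodes s ->
  exists2 n, (n < N)%N & t n < s < t n.+1.
Proof.
rewrite /nodes; elim: N => [|k IH].
  by move=> /andP[a b]; have := lt_trans a b; rewrite ltxx.
move=> /andP[s0 s1] ns.
have [sk|ks|sk] := ltgtP s (t k); last by case: ns; exists k => //=; rewrite -sk.
  have [||n nk sn] := IH; first by rewrite s0.
    by move=> [j /= jk js]; apply: ns; exists j => //=; rewrite ltnS ltnW.
  by exists n => //; rewrite ltnS ltnW.
by exists k => //; rewrite ks.
Qed.

Lemma closed_slab_index s : (0 < N)%N -> t 0 <= s <= t N ->
  exists2 n, (n < N)%N & t n <= s <= t n.+1.
Proof.
elim: N => // k IH _ /andP[s0 s1].
have [sk|sk] := leP (t k) s; first by exists k => //; rewrite sk.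
case: k IH s1 sk => [|k] IH s1 sk; first by rewrite leNgt sk in s0.
have [//||n nk sn] := IH; first by rewrite s0 ltW.
by exists n => //; exact: ltnW.
Qed.

Hypothesis t_incr : forall n, (n < N)%N -> t n < t n.+1.

Lemma partition_le i j : (i <= j <= N)%N -> t i <= t j.
Proof.
move=> /andP[]; elim: j => [|j IH].
  by rewrite leqn0 => /eqP ->.
rewrite leq_eqVlt => /predU1P[-> //|]; rewrite ltnS => ij jN.
by rewrite (le_trans (IH ij (ltnW jN)))// ltW// t_incr.
Qed.

Lemma partition_bounds n s : (n < N)%N -> t n <= s <= t n.+1 -> t 0 <= s <= t N.
Proof.
move=> nN /andP[ns sn]; rewrite (le_trans _ ns) ?(le_trans sn)//.
  by rewrite partition_le// nN leqnn.
by rewrite partition_le// leq0n ltnW.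
Qed.

Lemma partition_strict_bounds n s : (n < N)%N -> t n < s < t n.+1 -> t 0 < s < t N.
Proof.
move=> nN /andP[ns sn]; rewrite (le_lt_trans _ ns) ?(lt_le_trans sn)//.
  by rewrite partition_le// nN leqnn.
by rewrite partition_le// leq0n ltnW.
Qed.

Lemma partition_uniq i j s : (i < N)%N -> (j < N)%N ->
  t i < s < t i.+1 -> t j < s < t j.+1 -> i = j.
Proof.
move=> iN jN /andP[i1 i2] /andP[j1 j2]; case: (ltngtP i j) => // ij.
- have := @partition_le i.+1 j; rewrite ij ltnW// => /(_ isT).
  by rewrite leNgt (lt_trans j1 i2).
- have := @partition_le j.+1 i; rewrite ij ltnW// => /(_ isT).
  by rewrite leNgt (lt_trans i1 j2).
Qed.

End partition.

Section slabs.
Context d (X : measurableType d) (R : realType).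
Variable mu : {sigma_finite_measure set X -> \bar R}.
Local Notation lambda := (@lebesgue_measure R).
Local Notation XR := (X * measurableTypeR R)%type.

Lemma Lfun2_tensor (w : X -> R) (h : R -> R) :
  w \in Lfun mu 2%:E -> h \in Lfun lambda 2%:E ->
  (fun z : XR => w z.1 * h z.2) \in Lfun (mu \x lambda)%E 2%:E.
Proof.
move=> /[dup] /Lfun2_measurable mw /Lfun2_integrable_sqr/integrableP[_ w2].
move=> /[dup] /Lfun2_measurable mh /Lfun2_integrable_sqr/integrableP[_ h2].
have mwh : measurable_fun setT (fun z : XR => w z.1 * h z.2).
  apply: measurable_funM.
    exact: (measurableT_comp mw measurable_fst).
  exact: (measurableT_comp mh measurable_snd).
apply/Lfun2P; split=> //.
apply/(integrable12ltyP mu lambda).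
  by apply/measurable_EFinP; exact: measurable_funX.
have msqr d' (Y : measurableType d') (g : Y -> R) : measurable_fun setT g ->
    measurable_fun setT (fun y => `|(g y ^+ 2)%:E|)%E.
  by move=> mg; apply/measurable_EFinP; apply: measurableT_comp => //; exact: measurable_funX.
set A := (\int[lambda]_x `|(EFin \o (fun x => (h x ^+ 2)%R)) x|)%E in h2.
have A0 : (0 <= A)%E by exact: integral_ge0.
under eq_integral => x _.
  under eq_integral => s _ do rewrite /= exprMn normrM EFinM.
  rewrite ge0_integralZl//; last exact: msqr.
  over.
rewrite ge0_integralZr//=; last exact: msqr.
by rewrite lte_mul_pinfty ?integral_ge0// ge0_fin_numE ?integral_ge0.
Qed.

Lemma restrict_horner_Lfun2 a b (p : {poly R}) :
  (horner p \_ `]a, b[) \in Lfun lambda 2%:E.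
Proof.
apply/Lfun2P; split.
  apply/(measurable_restrictT _ _).1 => //.
  by have /measurable_EFinP := measurable_int _ (integrable_horner false true a b p).
have -> : EFin \o (fun x => (horner p \_ `]a, b[) x ^+ 2) =
    (EFin \o horner (p * p)) \_ `]a, b[.
  apply/funext => s /=; rewrite !patchE; case: ifPn => // _ /=.
    by rewrite hornerM expr2.
  by rewrite expr0n.
by apply/(integrable_mkcond _ _).1 => //; exact: integrable_horner.
Qed.

Definition L2poly (m : nat) (U : X -> {poly R}) : Prop :=
  (forall x, (size (U x) <= m)%N) /\ forall k, (fun x => (U x)`_k) \in Lfun mu 2%:E.

Lemma L2poly_linear (m m' : nat) (M : {linear {poly R} -> {poly R}}) U :
  (forall p : {poly R}, (size p <= m)%N -> (size (M p) <= m')%N) ->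
  L2poly m U -> L2poly m' (M \o U).
Proof.
move=> sM [sU U2]; split=> [x|k /=]; first exact: sM.
under eq_fun do rewrite (coef_linear_sum _ _ (sU _)).
by apply: Lfun2_sum => j; exact: Lfun2Z.
Qed.

Lemma L2poly_horner m U s : L2poly m U -> (fun x => (U x).[s]) \in Lfun mu 2%:E.
Proof.
move=> [sU U2]; under eq_fun do rewrite (horner_coef_wide _ (sU _)).
by apply: Lfun2_sum => k; under eq_fun do rewrite mulrC; exact: Lfun2Z.
Qed.

Definition slab (a b : R) (U : X -> {poly R}) (z : XR) : R :=
  ((horner (U z.1)) \_ `]a, b[) z.2.

Lemma slab_Lfun2 m a b U : L2poly m U -> slab a b U \in Lfun (mu \x lambda)%E 2%:E.
Proof.
move=> [sU U2].
have -> : slab a b U = fun z => \sum_(k < m) (U z.1)`_k * (horner 'X^k \_ `]a, b[) z.2.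
  apply/funext => -[x s]; rewrite /slab/= !patchE; case: ifPn => sI.
    rewrite (horner_coef_wide _ (sU x)); apply: eq_bigr => k _.
    by rewrite patchE sI hornerXn.
  by rewrite big1// => k _; rewrite patchE (negbTE sI) mulr0.
by apply: Lfun2_sum => k; exact: (Lfun2_tensor (U2 k) (restrict_horner_Lfun2 a b 'X^k)).
Qed.

Lemma slab_mul a b U V z :
  slab a b (fun x => U x * V x) z = slab a b U z * slab a b V z.
Proof. by rewrite /slab !patchE; case: ifPn => _; rewrite ?hornerM// mul0r. Qed.

Definition slab_ip a b U V : R := \int[mu]_x pint a b (U x * V x).

Lemma fubini_F_slab a b U :
  fubini_F lambda (EFin \o slab a b U) = fun x => (pint a b (U x))%:E.
Proof.
apply/funext => x; rewrite /fubini_F /pint /Rintegral fineK.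
  rewrite [RHS]integral_mkcond; apply: eq_integral => s _.
  by rewrite /slab/= !patchE; case: ifP.
by apply: integrable_fin_num => //; exact: integrable_horner.
Qed.

Section products.
Variables (a b : R) (m m' : nat) (U V : X -> {poly R}).
Hypotheses (U2 : L2poly m U) (V2 : L2poly m' V).

Lemma integrable_slab_mul :
  (mu \x lambda)%E.-integrable setT (EFin \o slab a b (fun x => U x * V x)).
Proof.
rewrite (_ : EFin \o _ = fun z => (slab a b U z * slab a b V z)%:E).
  exact: Lfun2_mul_integrable (slab_Lfun2 a b U2) (slab_Lfun2 a b V2).
by apply/funext => z; rewrite /= slab_mul.
Qed.

Lemma integrable_pint_mul : mu.-integrable setT (EFin \o (fun x => pint a b (U x * V x))).
Proof. by have := integrable_fubini_F integrable_slab_mul; rewrite fubini_F_slab. Qed.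

Lemma Rintegral_slab_mul :
  \int[(mu \x lambda)%E]_z slab a b (fun x => U x * V x) z = slab_ip a b U V.
Proof.
rewrite /Rintegral -(integral12_prod_meas1 integrable_slab_mul); congr fine.
by apply: eq_integral => x _; rewrite fubini_F_slab.
Qed.

End products.

Lemma le_slab_ip a b m1 m2 m3 m4 U1 U2 U3 U4 :
  L2poly m1 U1 -> L2poly m2 U2 -> L2poly m3 U3 -> L2poly m4 U4 ->
  (forall x, pint a b (U1 x * U2 x) <= pint a b (U3 x * U4 x)) ->
  slab_ip a b U1 U2 <= slab_ip a b U3 U4.
Proof.
move=> L1 L2 L3 L4 le_pint_U; apply: le_Rintegral => //.
- exact: integrable_pint_mul L1 L2.
- exact: integrable_pint_mul L3 L4.
Qed.

Variables (N : nat) (t : nat -> R) (t_incr : forall n, (n < N)%N -> t n < t n.+1).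
Implicit Types U V : nat -> X -> {poly R}.

Definition slabs U (z : XR) : R := \sum_(n < N) slab (t n) (t n.+1) (U n) z.

Lemma slabsE U n x s : (n < N)%N -> t n < s < t n.+1 -> slabs U (x, s) = (U n x).[s].
Proof.
move=> nN sn; rewrite /slabs (bigD1 (Ordinal nN))//= big1 ?addr0.
  by rewrite /slab/= patchE mem_set//= in_itv.
move=> j jn; rewrite /slab patchE memNset//= in_itv /= => sj.
by move/eqP: jn; apply; apply/val_inj; exact: (partition_uniq t_incr) sj sn.
Qed.

Lemma slabs_eq0 U x s : ~ (exists2 n, (n < N)%N & t n < s < t n.+1) -> slabs U (x, s) = 0.
Proof.
move=> ns; rewrite /slabs big1// => n _; rewrite /slab patchE memNset//= in_itv/= => sn.
by apply: ns; exists n.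
Qed.

Lemma slabs_mul U V z : slabs U z * slabs V z = slabs (fun n x => U n x * V n x) z.
Proof.
case: z => x s; have [[n nN sn]|ns] := pselect (exists2 n, (n < N)%N & t n < s < t n.+1).
  by rewrite !(slabsE _ _ nN sn) hornerM.
by rewrite !slabs_eq0// mul0r.
Qed.

Lemma slabs_Lfun2 m U : (forall n, (n < N)%N -> L2poly m (U n)) ->
  slabs U \in Lfun (mu \x lambda)%E 2%:E.
Proof. by move=> U2; apply: Lfun2_sum => n; apply: slab_Lfun2; exact: U2. Qed.

Lemma Rintegral_slabs_mul m m' U V :
  (forall n, (n < N)%N -> L2poly m (U n)) -> (forall n, (n < N)%N -> L2poly m' (V n)) ->
  \int[(mu \x lambda)%E]_z (slabs U z * slabs V z) =
  \sum_(n < N) slab_ip (t n) (t n.+1) (U n) (V n).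
Proof.
move=> U2 V2; under eq_Rintegral do rewrite slabs_mul.
rewrite Rintegral_sum => [|n]; last exact: integrable_slab_mul (U2 n _) (V2 n _).
by apply: eq_bigr => n _; exact: Rintegral_slab_mul (U2 n _) (V2 n _).
Qed.

Lemma Lnorm2_slabs_le m U (b : R) : (forall n, (n < N)%N -> L2poly m (U n)) -> 0 <= b ->
  (forall n s, (n < N)%N -> t n < s < t n.+1 -> \int[mu]_x ((U n x).[s] ^+ 2) <= b ^+ 2) ->
  forall s, ('N[mu]_2%:E[EFin \o (fun x => slabs U (x, s))] <= b%:E)%E.
Proof.
move=> U2 b0 Ub s.
have [[n nN sn]|ns] := pselect (exists2 n, (n < N)%N & t n < s < t n.+1).
  under eq_fun do rewrite (slabsE U _ nN sn).
  rewrite (Lfun2_Lnorm (L2poly_horner s (U2 n nN))) lee_fin.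
  by rewrite -(ger0_norm b0) -sqrtr_sqr ler_wsqrtr// Ub.
under eq_fun do rewrite slabs_eq0//.
by rewrite (_ : EFin \o _ = cst 0%E) ?Lnorm0.
Qed.

End slabs.

Section slab_energy.
Context d (X : measurableType d) (R : realType).
Variable mu : {sigma_finite_measure set X -> \bar R}.
Variables (a b : R) (ab : a < b) (m : nat) (U : X -> {poly R}).
Hypothesis U2 : L2poly mu m.+1 U.

Let sqr_horner_integrable s : mu.-integrable setT (EFin \o (fun x => (U x).[s] ^+ 2)).
Proof. exact: Lfun2_integrable_sqr (L2poly_horner s U2). Qed.

Lemma L2poly_deriv : L2poly mu m (fun x => (U x)^`()).
Proof. exact: (L2poly_linear (M := @deriv R) (@size_deriv_leq _ m) U2). Qed.

Lemma slab_ip_deriv_pproj :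
  slab_ip mu a b (fun x => (U x)^`()) (pproj a b m \o U) =
  (\int[mu]_x ((U x).[b] ^+ 2) - \int[mu]_x ((U x).[a] ^+ 2)) / 2.
Proof.
rewrite -RintegralB// -RintegralZr//; last first.
  exact: (integrableB measurableT (sqr_horner_integrable b) (sqr_horner_integrable a)).
by apply: eq_Rintegral => x _; apply: (pint_deriv_pproj ab); have [+ _] := U2; apply.
Qed.

Lemma slab_ip_deriv_wproj_ge :
  (slab_ip mu a b U U / (b - a) - \int[mu]_x ((U x).[a] ^+ 2)) / 2 <=
  slab_ip mu a b (fun x => (U x)^`()) (wproj a b m \o U).
Proof.
have W2 : L2poly mu m (wproj a b m \o U).
  by apply: L2poly_linear U2 => r _; exact: size_pproj.
have iUU := integrableZr measurableT (b - a)^-1 (integrable_pint_mul a b U2 U2).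
have iB := integrableB measurableT iUU (sqr_horner_integrable a).
rewrite -RintegralZr//; last exact: integrable_pint_mul U2 U2.
rewrite -RintegralB// -RintegralZr//.
apply: le_Rintegral => //.
- exact: (integrableZr measurableT _ iB).
- exact: integrable_pint_mul L2poly_deriv W2.
move=> x _; have [sU _] := U2.
by have := pint_deriv_wproj_ge ab (sU x); rewrite mulrBl.
Qed.

Lemma slab_inverse_estimate K s : inverse_constant m.+1 K -> a <= s <= b ->
  \int[mu]_x ((U x).[s] ^+ 2) <= K * (slab_ip mu a b U U / (b - a)).
Proof.
move=> KP sab; have iUU := integrable_pint_mul a b U2 U2.
rewrite mulrA ler_pdivlMr ?subr_gt0// mulrC.
rewrite -RintegralZl ?sqr_horner_integrable// -RintegralZl//.
apply: le_Rintegral => //.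
- exact: (integrableZl measurableT _ (sqr_horner_integrable s)).
- exact: (integrableZl measurableT _ iUU).
by move=> x _; apply: KP => //; have [+ _] := U2; apply.
Qed.

End slab_energy.

Section flat_functions.
Context {R : realType}.
Implicit Types (P : {poly R}) (f g : R -> R) (c e x y : R).

(* The derivatives of [exp (- 1 / x)] are of this form, hence the polynomial factor. *)
Definition flat P x : R := if 0 < x then P.[x^-1] * expR (- x^-1) else 0.

Lemma flat_ge0_le1 x : 0 <= flat 1 x <= 1.
Proof.
rewrite /flat hornerC mul1r; case: ifPn => [x0|_]; last by rewrite lexx ler01.
by rewrite expR_ge0 expR_le1 oppr_le0 invr_ge0 ltW.
Qed.

Lemma flat_quadratic_bound P : exists2 C : R, 0 <= C & forall x, `|flat P x| <= C * x ^+ 2.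
Proof.
have C0 : 0 <= \sum_(i < size P) `|P`_i| * (i.+2)`!%:R.
  by apply: sumr_ge0 => i _; rewrite mulr_ge0.
exists (\sum_(i < size P) `|P`_i| * (i.+2)`!%:R) => // x.
rewrite /flat; case: ifPn => [x0|_]; last by rewrite normr0 mulr_ge0// sqr_ge0.
rewrite normrM (ger0_norm (expR_ge0 _)) horner_coef mulr_suml.
rewrite (le_trans (ler_wpM2r (expR_ge0 _) (ler_norm_sum _ _ _)))//.
rewrite mulr_suml ler_sum// => i _; rewrite normrM -!mulrA ler_wpM2l//.
have xV0 : 0 <= x^-1 by rewrite invr_ge0 ltW.
rewrite ger0_norm ?exprn_ge0// expRN ler_pdivrMr ?expR_gt0//.
have exp_ge : x^-1 ^+ i.+2 / (i.+2)`!%:R <= expR x^-1.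
  by rewrite (le_trans _ (expR_ge1Dxn i.+1 xV0))// lerDr.
rewrite ler_pdivrMr ?ltr0n ?fact_gt0// in exp_ge.
have -> : x^-1 ^+ i = x^-1 ^+ i.+2 * x ^+ 2.
  by rewrite -addn2 exprD -mulrA -exprMn mulVf ?gt_eqF// expr1n mulr1.
by rewrite [leRHS]mulrAC ler_wpM2r ?sqr_ge0// mulrC.
Qed.

Lemma is_derive_expRVN P x : x != 0 ->
  is_derive x 1 (fun y : R => P.[y^-1] * expR (- y^-1))
    (('X^2 * (P - P^`())).[x^-1] * expR (- x^-1)).
Proof.
move=> x0.
have dV : is_derive x (1 : R) (fun y : R => y^-1) (- x ^- 2).
  by have := is_deriveV x0 (is_derive_id x (1 : R)); rewrite /= -[_ *: _]/(_ * _) mulr1.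
have dN : is_derive x (1 : R) (fun y : R => - y^-1) (- - x ^- 2) by exact: is_deriveN.
have dE : is_derive x (1 : R) (fun y : R => expR (- y^-1)) (expR (- x^-1) * - - x ^- 2).
  exact: (@is_derive1_comp _ expR (fun y => - y^-1)).
have dP := is_derive1_comp (is_derive_poly P x^-1) dV.
apply: is_derive_eq (is_deriveM dP dE) _.
rewrite !(hornerM, hornerD, hornerN, hornerXn) -!exprVn /= -![_ *: _]/(_ * _).
by rewrite !hornerX; ring.
Qed.

Lemma is_derive_flat0 P : is_derive (0 : R) 1 (flat P) 0.
Proof.
have [C C0 CP] := flat_quadratic_bound P.
have flat0 : flat P 0 = 0 by rewrite /flat ltxx.
have slope0 : (fun h => h^-1 *: ((flat P \o shift 0) (h *: 1) - flat P 0)) @ 0^' --> (0 : R).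
  apply/cvgrPdist_lt => e e0; near=> h.
  have h0 : h != 0 by near: h; exact: nbhs_dnbhs_neq.
  rewrite /= addr0 -[h *: 1]/(h * 1) mulr1 flat0 subr0 sub0r normrN.
  rewrite -[_ *: _]/(_ * _) normrM normfV.
  rewrite (@le_lt_trans _ _ ((C + 1) * `|h|))//.
    rewrite ler_pdivrMl ?normr_gt0// (le_trans (CP h))// [leRHS]mulrCA -expr2.
    by rewrite real_normK ?num_real// ler_wpM2r ?sqr_ge0// lerDl.
  rewrite -ltr_pdivlMl; last by rewrite ltr_wpDl.
  by near: h; apply: dnbhs0_lt; rewrite mulr_gt0// invr_gt0 ltr_wpDl.
apply: DeriveDef; first by apply/cvg_ex; exists 0.
by rewrite /derive; move/cvg_lim: slope0 => ->.
Unshelve. all: by end_near. Qed.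

Lemma is_derive_flat P x : is_derive x 1 (flat P) (flat ('X^2 * (P - P^`())) x).
Proof.
have [x0|x0|<-] := ltgtP 0 x.
- have flatE : \near x, P.[x^-1] * expR (- x^-1) = flat P x.
    near=> y; have y0 : 0 < y by near: y; exact: lt_nbhsr.
    by rewrite /flat y0.
  apply: (near_eq_is_derive flatE).
  by rewrite /flat x0; apply: is_derive_expRVN; rewrite gt_eqF.
- have flatE : \near x, (fun=> 0) x = flat P x.
    near=> y; have y0 : y < 0 by near: y; exact: lt_nbhsl.
    by rewrite /flat ltNge (ltW y0).
  apply: (near_eq_is_derive flatE); rewrite /flat ltNge (ltW x0)/=.
  exact: is_derive_cst.
- by rewrite [flat ('X^2 * _) 0]/flat ltxx; exact: is_derive_flat0.
Unshelve. all: by end_near. Qed.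

Fixpoint times_derivable k f : Prop :=
  if k is k'.+1
  then (forall x, derivable f x 1) /\ times_derivable k' (derive1 f) else True.

Lemma times_derivableS k f : times_derivable k.+1 f -> times_derivable k f.
Proof. by elim: k f => // k IH f [df sf]; split => //; exact: IH. Qed.

Lemma times_derivable_flat k P : times_derivable k (flat P).
Proof.
elim: k P => // k IH P; split=> [x|]; first by have [] := is_derive_flat P x.
rewrite (_ : (derive1 _) = flat ('X^2 * (P - P^`())))//.
by apply/funext => x; rewrite derive1E; have [_ ->] := is_derive_flat P x.
Qed.

Lemma times_derivableD k f g :
  times_derivable k f -> times_derivable k g -> times_derivable k (f \+ g).
Proof.
elim: k f g => // k IH f g [df sf] [dg sg]; split=> [x|]; first exact: derivableD.
rewrite (_ : (derive1 _) = (derive1 f) \+ (derive1 g)); first exact: IH.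
by apply/funext => x; rewrite derive1E deriveD// /= !derive1E.
Qed.

Lemma times_derivableM k f g :
  times_derivable k f -> times_derivable k g -> times_derivable k (f \* g).
Proof.
elim: k f g => // k IH f g sf sg.
have [df sf'] := sf; have [dg sg'] := sg; split=> [x|]; first exact: derivableM.
rewrite (_ : (derive1 _) = (f \* (derive1 g)) \+ (g \* (derive1 f))).
  by apply: times_derivableD; apply: IH => //; exact: times_derivableS.
by apply/funext => x; rewrite derive1E deriveM// /= !derive1E.
Qed.

Lemma times_derivable_cst k c : times_derivable k (fun=> c).
Proof.
elim: k c => // k IH c; split=> [x|]; first exact: derivable_cst.
rewrite (_ : (derive1 _) = fun=> 0)//.
by apply/funext => x; rewrite derive1E derive_cst.
Qed.

Lemma times_derivable_affine k c e f :
  times_derivable k f -> times_derivable k (fun x => f (c * x + e)).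
Proof.
elim: k f => // k IH f [df sf].
have d_affine x : is_derive x (1 : R) (fun x => c * x + e) c.
  have -> : (fun x => c * x + e) = horner (c *: 'X + e%:P).
    by apply/funext => y; rewrite !hornerE.
  have := is_derive_poly (c *: 'X + e%:P) x.
  by rewrite derivD derivZ derivX derivC addr0 hornerZ hornerC mulr1.
have d_comp x : is_derive x (1 : R) (fun x => f (c * x + e)) ((derive1 f) (c * x + e) * c).
  have df' : is_derive (c * x + e) (1 : R) f ((derive1 f) (c * x + e)).
    by apply: DeriveDef => //; rewrite derive1E.
  exact: (@is_derive1_comp _ f (fun x => c * x + e)  _ _ _ df' (d_affine x)).
split=> [x|]; first by have [] := d_comp x.
rewrite (_ : (derive1 _) = (fun x => (derive1 f) (c * x + e)) \* (fun=> c)).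
  by apply: times_derivableM; [exact: IH|exact: times_derivable_cst].
by apply/funext => x; rewrite derive1E; have [_ ->] := d_comp x.
Qed.

End flat_functions.

Section boxes.
Context {R : realType} {d : nat}.
Implicit Types (a c x : 'rV[R]_d) (A Omega : set 'rV[R]_d).

Definition box a c : set 'rV[R]_d := [set x | forall i, a ord0 i < x ord0 i < c ord0 i].

Definition cbox a c : set 'rV[R]_d := [set x | forall i, a ord0 i <= x ord0 i <= c ord0 i].

Lemma box_cbox a c : box a c `<=` cbox a c.
Proof. by move=> x xac i; have /andP[/ltW -> /ltW ->] := xac i. Qed.

Lemma measurable_box a c : measurable (box a c).
Proof.
rewrite (_ : box a c = \bigcap_(i in [set: 'I_d]) (fun x => x ord0 i) @^-1` `]a ord0 i, c ord0 i[).
  apply: fin_bigcap_measurable => //= i _.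
  rewrite -[X in measurable X]setTI; exact: measurable_coord.
apply/seteqP; split=> x; rewrite /box/=.
  by move=> ac i _ /=; rewrite in_itv/=.
by move=> ac i; have := ac i I; rewrite /= in_itv/=.
Qed.

Lemma boxI a c a' c' : box a c `&` box a' c' =
  box (\row_i Num.max (a ord0 i) (a' ord0 i)) (\row_i Num.min (c ord0 i) (c' ord0 i)).
Proof.
apply/seteqP; split=> x /=; rewrite /box/=.
  move=> [xac xac'] i; rewrite !mxE gt_max lt_min.
  by have /andP[-> ->] := xac i; have /andP[-> ->] := xac' i.
move=> xac; split=> i; have := xac i; rewrite !mxE gt_max lt_min.
  by move=> /andP[/andP[-> _] /andP[-> _]].
by move=> /andP[/andP[_ ->] /andP[_ ->]].
Qed.

Lemma compact_cbox a c : compact (cbox a c).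
Proof.
have -> : cbox a c = [set v | forall i, `[a ord0 i, c ord0 i]%classic (v ord0 i)].
  by apply/seteqP; split=> x xac i; have := xac i; rewrite /= in_itv/=.
apply: (@rV_compact R d (fun i => `[a ord0 i, c ord0 i]%classic)) => i.
exact: segment_compact.
Qed.

Lemma closure_box a c : closure (box a c) `<=` cbox a c.
Proof.
rewrite [X in _ `<=` X](closure_id (cbox a c)).1; first exact: closureS (@box_cbox a c).
by apply: compact_closed; [exact: norm_hausdorff|exact: compact_cbox].
Qed.

Lemma open_rat_box Omega x : open Omega -> Omega x ->
  exists z : 'rV[rat]_d * 'rV[rat]_d,
    box (map_mx ratr z.1) (map_mx ratr z.2) x /\
    cbox (map_mx ratr z.1) (map_mx ratr z.2) `<=` Omega.
Proof.
move=> oOmega Ox; have /nbhs_ballP[e /= e0 eO] := open_nbhs_nbhs (conj oOmega Ox).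
have rat_between (y z : R) : y < z -> exists r : rat, y < ratr r < z.
  by move=> /rat_in_itvoo[r]; rewrite in_itv/= => yrz; exists r.
have /choice[a aP] i : exists r : rat, x ord0 i - e < ratr r < x ord0 i.
  by apply: rat_between; rewrite ltrBlDr ltrDl.
have /choice[c cP] i : exists r : rat, x ord0 i < ratr r < x ord0 i + e.
  by apply: rat_between; rewrite ltrDl.
exists (\row_i a i, \row_i c i); split.
  by move=> i; rewrite !mxE; have /andP[_ ->] := aP i; have /andP[-> _] := cP i.
move=> y yac; apply: eO; split => // i j; rewrite !ord1 {i}.
have := yac j; rewrite !mxE => /andP[ay yc].
have /andP[xa _] := aP j; have /andP[_ cx] := cP j.
rewrite /ball/= ltr_distl; apply/andP; split; lra.
Qed.

Lemma measurable_open Omega : open Omega -> measurable Omega.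
Proof.
move=> oOmega.
pose B (z : 'rV[rat]_d * 'rV[rat]_d) := box (map_mx ratr z.1) (map_mx (@ratr R) z.2).
have -> : Omega = \bigcup_(z in [set z | B z `<=` Omega]) B z.
  apply/seteqP; split=> [x Ox|x [z /= zO zx]]; last exact: zO.
  have [z [zx zO]] := open_rat_box oOmega Ox; exists z => //.
  exact: subset_trans (@box_cbox _ _) zO.
rewrite bigcup_mkcond; apply: countable_bigcupT_measurable; first exact: countableP.
by move=> z; case: ifP => _ //; exact: measurable_box.
Qed.

Lemma measurable_continuous (f : 'rV[R]_d -> R) : continuous f -> measurable_fun setT f.
Proof.
move=> cf; apply: (measurability _ (RGenOInfty.measurableE R)) => //.
move=> _ [_ [x ->] <-]; rewrite setTI; apply: measurable_open.
by apply: open_comp => // *; exact: cf.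
Qed.

Lemma continuous_compact_bounded (f : 'rV[R]_d -> R) A : continuous f -> compact A ->
  exists M : R, forall x, A x -> `|f x| < M.
Proof.
move=> cf cA; have : compact (f @` A).
  by apply: continuous_compact cA; exact: continuous_subspaceT.
move=> /compact_bounded[M [_ MP]]; exists (M + 2) => x Ax.
rewrite (@le_lt_trans _ _ (M + 1))//; last by rewrite ltrD2l ltr1n.
by apply: MP; [rewrite ltrDl|exists x].
Qed.

Lemma compact_sub_box A : compact A -> exists c, A `<=` box (- c) c.
Proof.
move=> cA; have /choice[M MP] i : exists M : R, forall x, A x -> `|x ord0 i| < M.
  by apply: continuous_compact_bounded cA; exact: coord_continuous.
by exists (\row_i M i) => x Ax i; rewrite !mxE -ltr_norml MP.
Qed.

Lemma measurable_rV_boxes :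
  @measurable _ 'rV[R]_d = <<s [set A | exists a c, A = box a c] >>.
Proof.
apply/seteqP; split; last first.
  apply: smallest_sub; first exact: sigma_algebra_measurable.
  by move=> _ [a [c ->]]; exact: measurable_box.
pose GT := g_sigma_algebraType [set A | exists a c, A = box a c].
suff mid : measurable_fun [set: GT] (id : GT -> 'rV[R]_d).
  by move=> A mA; have := mid measurableT A mA; rewrite setTI.
apply: measurable_fun_rVP => i.
apply: (measurability _ (RGenOInfty.measurableE R)) => //.
move=> _ [_ [y ->] <-]; rewrite setTI.
have -> : (fun x : GT => id x ord0 i) @^-1` `]y, +oo[%classic =
    \bigcup_n box (\row_j (if j == i then y else - n%:R)) (const_mx n%:R).
  apply/seteqP; split=> x /=; rewrite in_itv/= andbT; last first.
    by move=> [n _ /(_ i)]; rewrite !mxE eqxx => /andP[].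
  pose M : R := \sum_j `|x ord0 j|; move=> yx; exists (Num.truncn M).+1 => // j; rewrite !mxE.
  have : `|x ord0 j| < (Num.truncn M).+1%:R.
    by apply: le_lt_trans (truncnS_gt M); rewrite /M (bigD1 j)//= lerDl sumr_ge0.
  by rewrite ltr_norml => /andP[x1 ->]; rewrite andbT; case: eqP => // ->.
apply: bigcup_measurable => n _; apply: sub_sigma_algebra.
by eexists; eexists.
Qed.

End boxes.

Lemma leb_box_lty (R : realType) d (a c : 'rV[R]_d) : (leb d (box a c) < +oo)%E.
Proof.
elim: d a c => [|d IH] a c.
  by rewrite /= diracE; case: (_ \in _); rewrite ltry.
pose a' : 'rV[R]_d := @rsubmx R 1 1 d a; pose c' : 'rV[R]_d := @rsubmx R 1 1 d c.
pose I : set (measurableTypeR R) := `]a ord0 ord0, c ord0 ord0[%classic.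
have sub : @row_cons R d @^-1` box a c `<=` I `*` box a' c'.
  move=> [x y] xyac; split => /=.
    have := xyac ord0; rewrite /I/= in_itv /=.
    suff -> : @row_cons R d (x, y) ord0 ord0 = x by [].
    by have [->] := row_consK (x, y).
  move=> i; have := xyac (rshift 1 i).
  have -> : @row_cons R d (x, y) ord0 (rshift 1 i) = y ord0 i by exact: row_mxEr.
  by rewrite /a' /c' !mxE.
have mI : measurable I by exact: measurable_itv.
have mP : measurable (I `*` box a' c') by apply: measurableX => //; exact: measurable_box.
rewrite /= /pushforward.
apply: (@le_lt_trans _ _ ((lebesgue_measure \x leb d)%E (I `*` box a' c'))).
  apply: le_measure; rewrite ?inE//.
  rewrite -[X in measurable X]setTI; apply: measurable_row_cons => //.
  exact: measurable_box.
rewrite product_measure1E//; last exact: measurable_box.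
apply: lte_mul_pinfty => //; last exact: IH.
rewrite ge0_fin_numE//; have := @lebesgue_measure_itv R `]a ord0 ord0, c ord0 ord0[.
by move=> /= ->; case: ifP => _; rewrite ?ltry.
Qed.

Section tensor_products.
Context {R : realType} {d : nat}.
Implicit Types (f : 'I_d -> R -> R) (x : 'rV[R]_d).

Definition tensor f x : R := \prod_i f i (x ord0 i).

Lemma differentiable_tensor f x : (forall i (y : R), derivable (f i) y 1) ->
  differentiable (tensor f) x.
Proof.
move=> df; rewrite /tensor.
elim: (index_enum _) => [|i r IH].
  under eq_fun do rewrite big_nil; exact: differentiable_cst.
under eq_fun do rewrite big_cons.
apply: differentiableM => //.
apply: (@differentiable_comp _ _ _ _ (fun x : 'rV[R]_d => x ord0 i) (f i)).
  exact: differentiable_coord.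
exact/derivable1_diffP.
Qed.

Lemma partial_tensor f j : (forall i (y : R), derivable (f i) y 1) ->
  partial j (tensor f) = tensor (fun i => if i == j then derive1 (f j) else f i).
Proof.
move=> df; apply/funext => x; rewrite /partial /derive.
pose rest := \prod_(i | i != j) f i (x ord0 i).
have slopeE : (fun h => h^-1 *: ((tensor f \o shift x) (h *: delta_mx ord0 j) - tensor f x)) =
    (fun h => (h^-1 *: (f j (h + x ord0 j) - f j (x ord0 j))) * rest).
  apply/funext => h; rewrite /= /tensor (bigD1 j)//= [X in _ - X](bigD1 j)//=.
  rewrite (eq_bigr (fun i => f i (x ord0 i))); last first.
    by move=> i /negbTE ij; rewrite !mxE eqxx ij/= mulr0 add0r.
  by rewrite !mxE !eqxx mulr1 -mulrBl -![_ *: _]/(_ * _) mulrA.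
apply/cvg_lim; first exact: Rhausdorff.
have -> : tensor (fun i => if i == j then derive1 (f j) else f i) x =
    derive1 (f j) (x ord0 j) * rest.
  rewrite /tensor (bigD1 j)//= eqxx; congr (_ * _).
  by apply: eq_bigr => i /negbTE ->.
rewrite slopeE; apply: cvgMr_tmp; rewrite derive1E.
have := df j (x ord0 j); rewrite /derivable /derive.
set G := (X in cvg (X @ _) -> _); rewrite (_ : (fun h : R => _) = G)//.
by apply/funext => h; rewrite /G /= -[h *: 1]/(h * 1) mulr1.
Qed.

Lemma Ck_tensor f k : (forall i k', times_derivable k' (f i)) -> Ck k (tensor f).
Proof.
elim: k f => [|k IH] f sf /=; have df i (y : R) : derivable (f i) y 1 by have [] := sf i 1.
  by move=> x; apply: differentiable_continuous; exact: differentiable_tensor.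
split=> [x|j]; first exact: differentiable_tensor.
rewrite partial_tensor//; apply: IH => i k'; case: ifP => _; last exact: sf.
by have [] := sf j k'.+1.
Qed.

End tensor_products.

Section test_functions.
Context {R : realType} {d : nat}.
Variable Omega : set 'rV[R]_d.
Implicit Types (phi psi : 'rV[R]_d -> R).
Local Notation mu := (leb d : set 'rV[R]_d -> \bar R).

Lemma partial_axpy i (c : R) phi psi x :
  differentiable phi x -> differentiable psi x ->
  partial i (fun x => c * phi x + psi x) x = c * partial i phi x + partial i psi x.
Proof.
move=> dphi dpsi; rewrite /partial.
rewrite (@deriveD _ _ _ (fun x => c * phi x) psi x); last 2 first.
- by apply: diff_derivable; exact: differentiableZ.
- exact: diff_derivable.
by rewrite (@deriveZ _ _ _ phi c); last exact: diff_derivable.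
Qed.

Lemma Ck_axpy k (c : R) phi psi : Ck k phi -> Ck k psi ->
  Ck k (fun x => c * phi x + psi x).
Proof.
elim: k phi psi => [|k IH] phi psi /=.
  move=> cphi cpsi x.
  exact: (cvgD (@cvgMl_tmp _ _ _ _ _ c _ (cphi x)) (cpsi x)).
move=> [dphi phi'] [dpsi psi']; split=> [x|i].
  apply: differentiableD => //; exact: differentiableZ.
rewrite (_ : partial i _ = (fun x => c * partial i phi x + partial i psi x)); first exact: IH.
by apply/funext => x; exact: partial_axpy.
Qed.

Lemma test_function_axpy (c : R) phi psi : test_function Omega phi -> test_function Omega psi ->
  test_function Omega (fun x => c * phi x + psi x).
Proof.
move=> [Cphi Kphi phiO] [Cpsi Kpsi psiO].
have sub : closure [set x | c * phi x + psi x != 0] `<=`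
    closure [set x | phi x != 0] `|` closure [set x | psi x != 0].
  rewrite -closureU; apply: closureS => x /= h.
  by have [phi0|] := eqVneq (phi x) 0; [right; rewrite phi0 mulr0 add0r in h|left].
split=> [k||]; first exact: Ck_axpy.
  apply: subclosed_compact (compactU Kphi Kpsi) sub; exact: closed_closure.
by move=> x /sub[/phiO|/psiO].
Qed.

Lemma test_function0 : test_function Omega (fun=> 0).
Proof.
have S0 : [set x : 'rV[R]_d | (0 : R) != 0] = set0.
  by rewrite -subset0 => x /=; rewrite eqxx.
split; last 2 first.
- by rewrite S0 closure0; exact: compact0.
- by rewrite S0 closure0.
elim=> [|k IH] /=; first exact: cst_continuous.
split=> [x|i]; first exact: differentiable_cst.
rewrite (_ : partial i _ = fun=> 0)//; apply/funext => x; exact: derive_cst.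
Qed.

Lemma test_function_partial i phi : test_function Omega phi -> test_function Omega (partial i phi).
Proof.
move=> [Cphi Kphi phiO]; set S := closure _ in Kphi phiO.
have cS : closed S by exact: closed_closure.
have sub : closure [set x | partial i phi x != 0] `<=` S.
  rewrite [X in _ `<=` X](closure_id S).1//; apply: closureS => x /= dx.
  apply: contrapT => xS; have near0 : \near x, (fun=> 0) x = phi x.
    have : nbhs x (~` S) by apply: open_nbhs_nbhs; split => //; exact: closed_openC.
    apply: filterS => y yS; apply/esym/eqP/negPn/negP => y0; apply: yS.
    exact: subset_closure.
  by move: dx; rewrite /partial -(near_eq_derive _ near0) derive_cst eqxx.
split=> [k||]; first by have [_ +] := Cphi k.+1; exact.
  by apply: subclosed_compact Kphi sub; exact: closed_closure.
exact: subset_trans sub phiO.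
Qed.

Lemma test_function_restrict phi : test_function Omega phi -> phi \_ Omega = phi.
Proof.
move=> [_ _ phiO]; apply/funext => x; rewrite patchE; case: ifPn => // /negP xO.
by apply/esym/eqP/negPn/negP => px; apply: xO; apply/mem_set/phiO/subset_closure.
Qed.

Lemma test_function_Lfun2 phi : test_function Omega phi -> phi \in Lfun mu 2%:E.
Proof.
move=> [Cphi Kphi _]; have cphi : continuous phi := Cphi 0.
have [c Sc] := compact_sub_box Kphi; have [M MP] := continuous_compact_bounded cphi Kphi.
apply: (@Lfun2_bounded _ _ _ _ _ (box (- c) c) `|M|).
- exact: measurable_box.
- exact: leb_box_lty.
- exact: measurable_continuous.
move=> x; have [->|phix0] := eqVneq (phi x) 0; first by rewrite normr0 mulr_ge0.
have xS : closure [set x | phi x != 0] x by exact: subset_closure.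
rewrite indicE mem_set ?mulr1; last exact: Sc.
exact: le_trans (ltW (MP _ xS)) (ler_norm M).
Qed.

End test_functions.

Section box_bumps.
Context {R : realType} {d : nat}.
Implicit Types (a c x : 'rV[R]_d).

Definition bump1 (n : nat) (a c y : R) : R :=
  flat 1 (n.+1%:R * (y - a)) * flat 1 (n.+1%:R * (c - y)).

Definition bump n a c : 'rV[R]_d -> R :=
  tensor (fun i => bump1 n (a ord0 i) (c ord0 i)).

Lemma times_derivable_bump1 k n (a c : R) : times_derivable k (bump1 n a c).
Proof.
have -> : bump1 n a c = (fun y => flat 1 (n.+1%:R * y + - (n.+1%:R * a))) \*
    (fun y => flat 1 (- n.+1%:R * y + n.+1%:R * c)).
  by apply/funext => y; rewrite /bump1; congr (flat _ _ * flat _ _); ring.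
by apply: times_derivableM; apply: times_derivable_affine; exact: times_derivable_flat.
Qed.

Lemma bump1_ge0_le1 n (a c y : R) : 0 <= bump1 n a c y <= 1.
Proof.
rewrite /bump1; have /andP[l0 l1] := flat_ge0_le1 (n.+1%:R * (y - a)).
have /andP[r0 r1] := flat_ge0_le1 (n.+1%:R * (c - y)).
by rewrite mulr_ge0//= mulr_ile1.
Qed.

Lemma bump1_eq0 n (a c y : R) : ~~ (a < y < c) -> bump1 n a c y = 0.
Proof.
rewrite negb_and /bump1 /flat !pmulr_rgt0// !subr_gt0.
by case/orP => /negbTE ->; rewrite ?mul0r ?mulr0.
Qed.

Lemma bump_ge0_le1 n a c x : 0 <= bump n a c x <= 1.
Proof.
apply: (big_ind (fun y : R => 0 <= y <= 1)); first by rewrite ler01 lexx.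
  by move=> y z /andP[y0 y1] /andP[z0 z1]; rewrite mulr_ge0//= mulr_ile1.
by move=> i _; exact: bump1_ge0_le1.
Qed.

Lemma bump_eq0 n a c x : ~ box a c x -> bump n a c x = 0.
Proof.
by move=> /existsNP[i /negP xi]; rewrite /bump /tensor (bigD1 i)//= bump1_eq0// mul0r.
Qed.

Lemma bump_le_indic n a c x : bump n a c x <= \1_(box a c) x.
Proof.
rewrite indicE; have /andP[_ b1] := bump_ge0_le1 n a c x.
by case: (boolP (x \in _)) => // /negP xb; rewrite bump_eq0// => /mem_set.
Qed.

Lemma flat_cvg1 (y : R) : 0 < y -> flat 1 (n.+1%:R * y) @[n --> \oo] --> (1 : R).
Proof.
move=> y0.
have -> : (fun n => flat 1 (n.+1%:R * y)) = (fun n => expR (- (n.+1%:R^-1 * y^-1))).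
  by apply/funext => n; rewrite /flat pmulr_rgt0// y0 hornerC mul1r invfM.
rewrite -[X in _ --> X]expR0; apply: continuous_cvg; first exact: continuous_expR.
rewrite -[X in _ --> X]oppr0; apply: cvgN; rewrite -[X in _ --> X](mul0r y^-1).
by apply: cvgMr_tmp; exact: cvg_harmonic.
Qed.

Lemma bump_cvg a c x : bump n a c x @[n --> \oo] --> (\1_(box a c) x : R).
Proof.
rewrite indicE; case: (boolP (x \in _)) => [/set_mem xb|/negP xb]; last first.
  rewrite (_ : (fun n => _) = fun=> 0); first exact: cvg_cst.
  by apply/funext => n; rewrite bump_eq0// => /mem_set.
have -> : true%:R = \prod_(i < d) (1 : R) by rewrite big1.
apply: cvg_big => [|i _]; first exact: mul_continuous.
have /andP[ax xc] := xb i.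
by rewrite -[X in _ --> X]mulr1 /bump1; apply: cvgM; apply: flat_cvg1; rewrite subr_gt0.
Qed.

Lemma test_function_bump n a c (Omega : set 'rV[R]_d) : cbox a c `<=` Omega ->
  test_function Omega (bump n a c).
Proof.
move=> acO; have sub : closure [set x | bump n a c x != 0] `<=` cbox a c.
  apply: subset_trans (@closure_box _ _ a c); apply: closureS => x /=.
  by move=> bx; apply: contrapT => /bump_eq0 xb; rewrite xb eqxx in bx.
split=> [k||]; last exact: subset_trans sub acO.
  by apply: Ck_tensor => i k'; exact: times_derivable_bump1.
by apply: subclosed_compact (@compact_cbox _ _ a c) sub; exact: closed_closure.
Qed.

Lemma bump_Lfun2 n a c : bump n a c \in Lfun (leb d) 2%:E.
Proof.
by apply: test_function_Lfun2; apply: (@test_function_bump n a c setT).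
Qed.

Lemma indic_box_Lfun2 a c : (\1_(box a c) : 'rV[R]_d -> R) \in Lfun (leb d) 2%:E.
Proof.
have mb := measurable_box a c.
apply: (@Lfun2_bounded _ _ _ _ _ (box a c) 1) => // [|x].
  exact: leb_box_lty.
by rewrite mul1r ger0_norm.
Qed.

End box_bumps.

Lemma ae_eq0_setI_closed d (X : measurableType d) (R : realType)
    (mu : {measure set X -> \bar R}) (G : set_system X) (f : X -> \bar R) :
  @measurable d X = <<s G>> -> setI_closed G -> mu.-integrable setT f ->
  (\int[mu]_x f x = 0)%E -> (forall A, G A -> (\int[mu]_(x in A) f x = 0)%E) ->
  {ae mu, forall x, f x = 0%E}.
Proof.
move=> mG GI fi f0 fG.
have f0_measurable A : measurable A -> (\int[mu]_(x in A) f x = 0)%E.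
  rewrite mG; move: A.
  apply: (dynkin_induction (P := fun A => (\int[mu]_(x in A) f x = 0)%E) mG) => //.
  - move=> A mA A0; have mAC := measurableC mA.
    move: f0; rewrite -(setUv A) integral_setU//=.
    + by rewrite A0 add0e.
    + by rewrite setUv; exact: measurable_int fi.
    + by apply/disj_setPS; rewrite setICr.
  - move=> F mF tF F0; rewrite integral_bigcup//.
      by apply: eseries0 => n _ _; exact: F0.
    by apply: integrableS fi => //; exact: bigcup_measurable.
have : ae_eq mu setT f (cst 0%E).
  by apply: integral_ae_eq => // E _ mE; rewrite f0_measurable// integral0.
by apply: filterS => x; apply.
Qed.

Section fundamental_lemma.
Context {R : realType} {d : nat}.
Local Notation mu := (leb d : set 'rV[R]_d -> \bar R).
Variables (Omega : set 'rV[R]_d) (h : 'rV[R]_d -> R).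
Hypothesis h2 : h \in Lfun mu 2%:E.
Hypothesis h_orthogonal : forall phi, test_function Omega phi -> \int[mu]_x (h x * phi x) = 0.

Let integrable_box a c : mu.-integrable setT (fun x => (h x * \1_(box a c) x)%:E).
Proof. by apply: Lfun2_mul_integrable => //; exact: indic_box_Lfun2. Qed.

Lemma orthogonal_integral_box a c : cbox a c `<=` Omega ->
  (\int[mu]_x (h x * \1_(box a c) x)%:E = 0)%E.
Proof.
move=> acO; have ibump n : mu.-integrable setT (fun x => (h x * bump n a c x)%:E).
  by apply: Lfun2_mul_integrable => //; exact: bump_Lfun2.
have [|||||_ _ bump_lim] := @dominated_convergence _ _ _ mu setT measurableT
  (fun n x => (h x * bump n a c x)%:E) (fun x => (h x * \1_(box a c) x)%:E)
  (fun x => (`|h x * \1_(box a c) x|)%:E).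
- by move=> n; exact: measurable_int (ibump n).
- exact: measurable_int (integrable_box a c).
- apply: aeW => x _; apply: cvg_EFin; first exact: nearW.
  by apply: cvgMl_tmp; exact: bump_cvg.
- exact: integrable_abse (integrable_box a c).
- apply: aeW => x n _; rewrite lee_fin !normrM ler_wpM2l//.
  have /andP[b0 _] := bump_ge0_le1 n a c x.
  by rewrite !ger0_norm// bump_le_indic.
have bump0 n : (\int[mu]_x (h x * bump n a c x)%:E = 0)%E.
  rewrite -[RHS]/(0%:E) -(h_orthogonal (test_function_bump n acO)) /Rintegral fineK//.
  by apply: integrable_fin_num => //; exact: ibump.
move: bump_lim; under eq_fun do rewrite bump0.
by move=> /cvg_lim <- //; rewrite lim_cst.
Qed.

Lemma orthogonal_ae_eq0_box a c : cbox a c `<=` Omega -> {ae mu, forall x, box a c x -> h x = 0}.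
Proof.
move=> acO; have : {ae mu, forall x, (h x * \1_(box a c) x)%:E = 0%E}.
  apply: (ae_eq0_setI_closed measurable_rV_boxes) => //.
  - by move=> _ _ [a1 [c1 ->]] [a2 [c2 ->]]; rewrite boxI; do 2 eexists.
  - exact: orthogonal_integral_box.
  - move=> _ [a1 [c1 ->]]; rewrite integral_mkcond.
    transitivity (\int[mu]_x (h x * \1_(box a1 c1 `&` box a c) x)%:E)%E.
      apply: eq_integral => x _; rewrite patchE !indicE in_setI.
      by case: (_ \in _) => //=; rewrite mulr0.
    rewrite boxI; apply: orthogonal_integral_box => x xb; apply: acO => i.
    have := xb i; rewrite !mxE ge_max le_min.
    by move=> /andP[/andP[_ ->] /andP[_ ->]].
by apply: filterS => x /[swap] xb; rewrite indicE mem_set// mulr1 => -[].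
Qed.

(* The indicator of a box is a bounded limit of test functions, and the boxes
   generate the Borel sets. *)
Lemma test_function_orthogonal_ae_eq0 : open Omega -> {ae mu, forall x, Omega x -> h x = 0}.
Proof.
move=> oOmega.
pose ratbox (z : 'rV[rat]_d * 'rV[rat]_d) := box (map_mx ratr z.1) (map_mx (@ratr R) z.2).
pose ratcbox (z : 'rV[rat]_d * 'rV[rat]_d) := cbox (map_mx ratr z.1) (map_mx (@ratr R) z.2).
pose F (n : nat) : set 'rV[R]_d :=
  if unpickle n is Some z
  then [set x | ratcbox z `<=` Omega /\ ratbox z x /\ h x <> 0] else set0.
have nF n : mu.-negligible (F n).
  rewrite /F; case: (unpickle n) => [z|]; last exact: negligible_set0.
  have [zO|zO] := pselect (ratcbox z `<=` Omega); last first.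
    by apply: (negligibleS _ (negligible_set0 mu)) => x [].
  apply: negligibleS (orthogonal_ae_eq0_box zO) => x /= [_ [Bx hx]] /(_ Bx).
  exact: hx.
apply: negligibleS (negligible_bigcup nF) => x /= /not_implyP[Ox hx].
have [z [zx zO]] := open_rat_box oOmega Ox.
by exists (pickle z) => //; rewrite /F pickleK.
Qed.

End fundamental_lemma.

Section weak_gradients.
Context {R : realType} {d : nat}.
Variable Omega : set 'rV[R]_d.
Implicit Types (phi psi v : 'rV[R]_d -> R) (g : 'rV[R]_d -> 'rV[R]_d).
Local Notation mu := (leb d : set 'rV[R]_d -> \bar R).

Lemma weak_grad_unique v g1 g2 : open Omega -> is_weak_grad Omega v g1 -> is_weak_grad Omega v g2 ->
  {ae mu, forall x, Omega x -> g1 x = g2 x}.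
Proof.
move=> oOmega [_ g12 vg1] [_ g22 vg2].
have coord_eq i : {ae mu, forall x, Omega x -> g1 x ord0 i = g2 x ord0 i}.
  pose h x := (-1) * g2 x ord0 i + g1 x ord0 i.
  have h2 : h \_ Omega \in Lfun mu 2%:E by exact: (L2_axpy (-1) (g22 i) (g12 i)).
  have h_orthogonal phi : test_function Omega phi -> \int[mu]_x ((h \_ Omega) x * phi x) = 0.
    move=> tphi; rewrite -L2ip_restrictl L2ip_axpyl//; last exact: test_function_Lfun2 tphi.
    by rewrite mulN1r -vg2// vg1// addNr.
  apply: filterS (test_function_orthogonal_ae_eq0 h2 h_orthogonal oOmega) => x h0 Ox.
  have := h0 Ox; rewrite patchE mem_set// /h mulN1r addrC => /eqP.
  by rewrite subr_eq0 => /eqP.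
by apply: filterS (filter_forall _ coord_eq) => x gx Ox; apply/rowP => i; exact: gx.
Qed.

Lemma is_weak_grad_ext v v' g g' : (forall x, Omega x -> v x = v' x) ->
  (forall x, Omega x -> g x = g' x) -> is_weak_grad Omega v g -> is_weak_grad Omega v' g'.
Proof.
move=> vv' gg' [v2 g2 vg].
have gE i : (fun x => g x ord0 i) \_ Omega = (fun x => g' x ord0 i) \_ Omega.
  by apply: eq_restrict => x Ox; rewrite gg'.
split=> [|i|phi tphi i]; first by rewrite /L2/= -(eq_restrict vv').
  by rewrite /L2/= -gE; exact: g2.
by rewrite !L2ip_restrictl -(eq_restrict vv') -gE -!L2ip_restrictl vg.
Qed.

Lemma is_weak_grad_axpy (c : R) v1 v2 g1 g2 :
  is_weak_grad Omega v1 g1 -> is_weak_grad Omega v2 g2 ->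
  is_weak_grad Omega (fun x => c * v1 x + v2 x) (fun x => c *: g1 x + g2 x).
Proof.
move=> [v12 g12 vg1] [v22 g22 vg2].
have coordE i : (fun x => (c *: g1 x + g2 x) ord0 i) = fun x => c * g1 x ord0 i + g2 x ord0 i.
  by apply/funext => x; rewrite !mxE.
split=> [|i|phi tphi i]; rewrite ?coordE; first exact: L2_axpy.
  exact: (L2_axpy c (g12 i) (g22 i)).
rewrite !L2ip_axpyl//; last 2 first.
- exact: test_function_Lfun2 tphi.
- exact: test_function_Lfun2 (test_function_partial i tphi).
by rewrite vg1// vg2// mulrN -opprD.
Qed.

Lemma is_weak_grad0 : is_weak_grad Omega (fun=> 0) (fun=> 0).
Proof.
have L20 : L2 mu Omega (fun=> 0).
  rewrite /L2/= (_ : _ \_ _ = fun=> 0); first exact: Lfun2_0.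
  by apply/funext => x; rewrite patchE; case: ifP.
split=> [//|i|phi tphi i]; first by under eq_fun do rewrite mxE.
rewrite /L2ip; under eq_Rintegral do rewrite mul0r.
under [in RHS]eq_Rintegral do rewrite mxE mul0r.
by rewrite /Rintegral !integral0 /= oppr0.
Qed.

Lemma is_weak_grad_sum I (r : seq I) (c : I -> R) (v : I -> 'rV[R]_d -> R)
    (g : I -> 'rV[R]_d -> 'rV[R]_d) :
  (forall i, is_weak_grad Omega (v i) (g i)) ->
  is_weak_grad Omega (fun x => \sum_(i <- r) c i * v i x) (fun x => \sum_(i <- r) c i *: g i x).
Proof.
move=> vg; elim: r => [|i r IH].
  under eq_fun do rewrite big_nil; under [X in is_weak_grad _ _ X]eq_fun do rewrite big_nil.
  exact: is_weak_grad0.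
under eq_fun do rewrite big_cons; under [X in is_weak_grad _ _ X]eq_fun do rewrite big_cons.
exact: is_weak_grad_axpy.
Qed.

Lemma test_function_L2 phi : test_function Omega phi -> L2 mu Omega phi.
Proof. by move=> tphi; rewrite /L2/= test_function_restrict//; exact: test_function_Lfun2 tphi. Qed.

Lemma test_function_grad_L2 phi : test_function Omega phi -> L2_field mu Omega (grad phi).
Proof.
move=> tphi i; under eq_fun do rewrite mxE.
by apply: test_function_L2; exact: test_function_partial.
Qed.

Lemma grad_axpy (c : R) phi psi : test_function Omega phi -> test_function Omega psi ->
  grad (fun x => c * phi x + psi x) = fun x => c *: grad phi x + grad psi x.
Proof.
move=> [Cphi _ _] [Cpsi _ _]; have [dphi _] := Cphi 1; have [dpsi _] := Cpsi 1.
by apply/funext => x; apply/rowP => i; rewrite !mxE partial_axpy.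
Qed.

Lemma H10_axpy (c : R) v1 v2 : H10 Omega v1 -> H10 Omega v2 -> H10 Omega (fun x => c * v1 x + v2 x).
Proof.
move=> [g1 vg1 approx1] [g2 vg2 approx2]; exists (fun x => c *: g1 x + g2 x).
  exact: is_weak_grad_axpy.
move=> e e0; pose e' := e / (`|c| + 1).
have e'0 : 0 < e' by rewrite divr_gt0// ltr_wpDl.
have e'E : `|c| * e' + e' = e.
  by rewrite -[X in _ + X]mul1r -mulrDl mulrC divfK// gt_eqF// ltr_wpDl.
have lt_e (a b : \bar R) : (0 <= a)%E -> (0 <= b)%E -> (a < e'%:E)%E -> (b < e'%:E)%E ->
    (`|c|%:E * a + b < e%:E)%E.
  move: a b => [a| |] [b| |]// _ _; rewrite -EFinM -EFinD !lte_fin => ae be.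
  by rewrite -e'E ler_ltD// ler_wpM2l// ltW.
have [phi1 [t1 v1_phi1 g1_phi1]] := approx1 _ e'0.
have [phi2 [t2 v2_phi2 g2_phi2]] := approx2 _ e'0.
have t12 := test_function_axpy c t1 t2.
have [L2v1 L2g1 _] := vg1; have [L2v2 L2g2 _] := vg2.
have [L2v _ _] := is_weak_grad_axpy c vg1 vg2.
exists (fun x => c * phi1 x + phi2 x); split => //.
- apply: le_lt_trans (lt_e _ _ _ _ v1_phi1 v2_phi2); rewrite ?Lnorm_ge0//.
  apply: L2norm_axpy_le; [exact: L2B (test_function_L2 t1)|exact: L2B (test_function_L2 t2)|
    exact: L2B (test_function_L2 t12)|].
  move=> x /=; rewrite -normrM; apply: le_trans (ler_normD _ _).
  by rewrite mulrBr opprD addrACA.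
- apply: le_lt_trans (lt_e _ _ _ _ g1_phi1 g2_phi2); rewrite ?Lnorm_ge0//.
  have L2phi1 := L2_fieldB L2g1 (test_function_grad_L2 t1).
  have L2phi2 := L2_fieldB L2g2 (test_function_grad_L2 t2).
  apply: le_trans (L2norm_enorm_axpy_le c L2phi1 L2phi2); rewrite (grad_axpy c t1 t2).
  under [X in (_ <= L2norm _ _ X)%E]eq_fun do rewrite scalerBr addrACA -opprD.
  exact: lexx.
Qed.

Lemma H10_0 : H10 Omega (fun=> 0).
Proof.
exists (fun=> 0) => [|e e0]; first exact: is_weak_grad0.
have L2norm_lt f : (forall x, f x = 0) -> (L2norm mu Omega f < e%:E)%E.
  move=> f0; rewrite /L2norm (_ : EFin \o _ = cst 0%E) ?Lnorm0 ?lte_fin//.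
  by apply/funext => x; rewrite /= patchE f0; case: ifP.
exists (fun=> 0); split; first exact: test_function0.
- by apply: L2norm_lt => x /=; rewrite subrr.
- apply: L2norm_lt => x; rewrite (_ : _ - _ = 0).
    by rewrite /enorm /dot big1 ?sqrtr0// => i _; rewrite mxE mul0r.
  by apply/rowP => i; rewrite !mxE /partial derive_cst subr0.
Qed.

End weak_gradients.

Section discrete_space.
Context {R : realType} {d : nat}.
Variables (Omega : set 'rV[R]_d) (Th : seq 'M[R]_(d.+1, d)) (p : nat).

Lemma Vh0 : Vh Omega Th p (fun=> 0).
Proof.
split; first exact: H10_0.
move=> K KT; exists 0; first by rewrite mpoly.msize0.
by move=> x _ _; rewrite mpoly.meval0.
Qed.

Lemma Vh_axpy (c : R) v w : Vh Omega Th p v -> Vh Omega Th p w ->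
  Vh Omega Th p (fun x => c * v x + w x).
Proof.
move=> [v1 vT] [w1 wT]; split; first exact: H10_axpy.
move=> K KT; have [P sP PE] := vT K KT; have [Q sQ QE] := wT K KT.
exists (c *: P + Q); last by move=> x xK xO; rewrite mpoly.mevalD mpoly.mevalZ PE// QE.
rewrite (leq_trans (mpoly.msizeD_le _ _))// geq_max sQ andbT.
by rewrite (leq_trans (mpoly.msizeZ_le _ _)).
Qed.

Lemma Vh_sum I (r : seq I) (c : I -> R) (w : I -> 'rV[R]_d -> R) :
  (forall i, Vh Omega Th p (w i)) -> Vh Omega Th p (fun x => \sum_(i <- r) c i * w i x).
Proof.
move=> wV; elim: r => [|i r IH]; first by under eq_fun do rewrite big_nil; exact: Vh0.
under eq_fun do rewrite big_cons.
exact: Vh_axpy.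
Qed.

End discrete_space.

Section time_polynomials.
Context {R : realType} {d : nat}.
Variables (Omega : set 'rV[R]_d) (Th : seq 'M[R]_(d.+1, d)) (p : nat).
Local Notation mu := (leb d : set 'rV[R]_d -> \bar R).
Implicit Types (U : 'rV[R]_d -> {poly R}) (G : 'I_d -> 'rV[R]_d -> {poly R}).

(* [U] represents an element of P^(m-1) (x) Vh on one time slab, and [G] its gradient;
   both are extended by [0] outside of the domain. *)
Definition Vh_poly (m : nat) U G : Prop :=
  exists w : nat -> 'rV[R]_d -> R, exists g : nat -> 'rV[R]_d -> 'rV[R]_d,
  [/\ forall k, Vh Omega Th p (w k),
      forall k, is_weak_grad Omega (w k) (g k),
      U = fun x => \poly_(k < m) (w k \_ Omega) x &
      G = fun i x => \poly_(k < m) ((fun x => g k x ord0 i) \_ Omega) x].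

Lemma Vh_poly_exists m (w : nat -> 'rV[R]_d -> R) : (forall k, Vh Omega Th p (w k)) ->
  exists G, Vh_poly m (fun x => \poly_(k < m) (w k \_ Omega) x) G.
Proof.
move=> wV; have /choice[g wg] k : exists g, is_weak_grad Omega (w k) g.
  by have [[g wg _] _] := wV k; exists g.
by exists (fun i x => \poly_(k < m) ((fun x => g k x ord0 i) \_ Omega) x); exists w, g.
Qed.

Lemma poly_restrict_L2poly m (h : nat -> 'rV[R]_d -> R) : (forall k, L2 mu Omega (h k)) ->
  L2poly mu m (fun x => \poly_(k < m) (h k \_ Omega) x).
Proof.
move=> h2; split=> [x|k]; first exact: size_poly.
under eq_fun do rewrite coef_poly.
by case: ltnP => _; [exact: h2|exact: Lfun2_0].
Qed.

Lemma Vh_poly_L2 m U G : Vh_poly m U G -> L2poly mu m U.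
Proof.
move=> [w [g [_ wg -> _]]]; apply: poly_restrict_L2poly => k; by have [] := wg k.
Qed.

Lemma Vh_poly_grad_L2 m U G i : Vh_poly m U G -> L2poly mu m (G i).
Proof.
move=> [w [g [_ wg _ ->]]]; apply: (@poly_restrict_L2poly m (fun k x => g k x ord0 i)) => k.
by have [_ + _] := wg k; exact.
Qed.

Lemma Vh_poly_eq0 m U G x : Vh_poly m U G -> ~ Omega x -> U x = 0.
Proof.
move=> [w [g [_ _ -> _]]] xO; apply/polyP => k.
by rewrite coef_poly coef0 patchE memNset//; case: ifP.
Qed.

Lemma Vh_poly_grad_eq0 m U G i x : Vh_poly m U G -> ~ Omega x -> G i x = 0.
Proof.
move=> [w [g [_ _ _ ->]]] xO; apply/polyP => k.
by rewrite coef_poly coef0 patchE memNset//; case: ifP.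
Qed.

Lemma linear_poly_restrict m m' (M : {linear {poly R} -> {poly R}})
    (h : nat -> 'rV[R]_d -> R) x :
  (forall r : {poly R}, (size r <= m)%N -> (size (M r) <= m')%N) ->
  M (\poly_(k < m) (h k \_ Omega) x) =
  \poly_(j < m') ((fun y => \sum_(k < m) (M 'X^k)`_j * h k y) \_ Omega) x.
Proof.
move=> sM; apply/polyP => j; rewrite coef_poly; case: ltnP => [_|mj]; last first.
  by rewrite nth_default// (leq_trans _ mj)// sM// size_poly.
rewrite (coef_linear_sum _ _ (size_poly _ _)) patchE.
case: ifPn => xO; last first.
  by rewrite big1// => k _; rewrite coef_poly ltn_ord patchE (negbTE xO) mulr0.
by apply: eq_bigr => k _; rewrite coef_poly ltn_ord patchE xO.
Qed.

Lemma Vh_poly_linear m m' (M : {linear {poly R} -> {poly R}}) U G :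
  (forall r : {poly R}, (size r <= m)%N -> (size (M r) <= m')%N) ->
  Vh_poly m U G -> Vh_poly m' (M \o U) (fun i => M \o G i).
Proof.
move=> sM [w [g [wV wg -> ->]]].
exists (fun j x => \sum_(k < m) (M 'X^k)`_j * w k x).
exists (fun j x => \sum_(k < m) (M 'X^k)`_j *: g k x); split.
- by move=> k; exact: Vh_sum.
- by move=> k; exact: is_weak_grad_sum.
- by apply/funext => x; rewrite /= (linear_poly_restrict w x sM).
- apply/funext => i; apply/funext => x.
  rewrite /= (linear_poly_restrict (fun k x => g k x ord0 i) x sM).
  apply: eq_poly => j _; congr ((_ \_ Omega) x); apply/funext => y.
  by rewrite summxE; apply: eq_bigr => k _; rewrite mxE.
Qed.

Lemma Vh_poly_horner m U G s : Vh_poly m U G ->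
  is_weak_grad Omega (fun x => (U x).[s]) (fun x => \row_i (G i x).[s]).
Proof.
move=> [w [g [_ wg -> ->]]].
apply: is_weak_grad_ext (is_weak_grad_sum (index_enum 'I_m) (fun k : 'I_m => s ^+ k)
  (fun k : 'I_m => wg k)) => x /mem_set xO.
  by rewrite horner_poly; apply: eq_bigr => k _; rewrite patchE xO mulrC.
apply/rowP => i; rewrite mxE horner_poly summxE; apply: eq_bigr => k _.
by rewrite patchE xO mulrC mxE.
Qed.

End time_polynomials.

Section spatial_gradients.
Context {R : realType} {d : nat}.
Variables (Omega : set 'rV[R]_d) (T : R).
Local Notation XT := ('rV[R]_d * measurableTypeR R)%type.
Local Notation Q := (QT Omega T : set XT).
Local Notation mu := (leb_xt d : set XT -> \bar R).
Hypothesis oOmega : open Omega.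
Implicit Types (u v : XT -> R) (G H : XT -> 'rV[R]_d).

Lemma xgrad_unique u G1 G2 : is_xgrad Omega T u G1 -> is_xgrad Omega T u G2 ->
  {ae mu, forall z, Q z -> G1 z = G2 z}.
Proof.
move=> [G12 uG1] [G22 uG2].
pose h i z : R := ((fun z => G1 z ord0 i) \_ Q) z - ((fun z => G2 z ord0 i) \_ Q) z.
have mh i : measurable_fun setT (h i).
  exact: measurable_funB (Lfun2_measurable (G12 i)) (Lfun2_measurable (G22 i)).
pose E : set XT := \bigcup_(i in [set: 'I_d]) (h i @^-1` (~` [set 0])).
have in_E z : E z <-> Q z /\ G1 z <> G2 z.
  split=> [[i _ /=]|[Qz G12z]].
    rewrite /h !patchE; case: ifPn => [/set_mem Qz hz|_]; last by rewrite subrr.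
    by split=> // Gz; apply: hz; rewrite Gz subrr.
  apply: contrapT => Ez; apply: G12z; apply/rowP => i; apply/eqP; rewrite -subr_eq0.
  apply/eqP; apply: contrapT => hz; apply: Ez; exists i => //=.
  by rewrite /h !patchE mem_set.
have mE : measurable E.
  apply: fin_bigcup_measurable => // i _; rewrite -[X in measurable X]setTI.
  by apply: mh => //; exact: measurableC.
exists E; split => //; last by move=> z /not_implyP Gz; apply/in_E.
apply: product_measure_ysection_eq0 => //.
have ae_filter := ae_filter_ringOfSetsType (@lebesgue_measure R).
apply: filterS2 uG1 uG2 => t uG1t uG2t; apply: measure_negligible.
  exact: measurable_ysection.
have [tT|tT] := boolP (0 < t < T); last first.
  rewrite (_ : ysection E t = set0); first exact: negligible_set0.
  rewrite -subset0 => x /ysectionP/in_E[[_ /=]]; rewrite in_itv/= => tT' _.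
  by rewrite tT' in tT.
apply: negligibleS (weak_grad_unique oOmega (uG1t tT) (uG2t tT)) => x /ysectionP/in_E[[Ox _] Gx] /=.
by move=> /(_ Ox).
Qed.

Lemma is_xgrad_xgrad u G : is_xgrad Omega T u G -> is_xgrad Omega T u (xgrad Omega T u).
Proof. by move=> uG; apply: (@xgetPex _ (fun=> 0) [set G | is_xgrad Omega T u G]); exists G. Qed.

Lemma xgrad_ipE u v G H : is_xgrad Omega T u G -> is_xgrad Omega T v H ->
  xgrad_ip Omega T u v = field_ip mu Q G H.
Proof.
move=> uG vH; have uX := is_xgrad_xgrad uG; have vX := is_xgrad_xgrad vH.
exact: (eq_ae_field_ip uX.1 uG.1 vX.1 vH.1 (xgrad_unique uX uG) (xgrad_unique vX vH)).
Qed.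

Lemma xgrad_norm_sqr u G : is_xgrad Omega T u G ->
  (xgrad_norm Omega T u ^+ 2 = (xgrad_ip Omega T u u)%:E)%E.
Proof. by move=> /is_xgrad_xgrad[X2 _]; exact: L2norm_enorm_sqr. Qed.

Lemma xgrad_ip_sqr_ge0 u : 0 <= xgrad_ip Omega T u u.
Proof. exact: field_ip_ge0. Qed.

Lemma xgrad_ip_le u v G H : is_xgrad Omega T u G -> is_xgrad Omega T v H ->
  xgrad_ip Omega T u v <= (xgrad_ip Omega T u u + xgrad_ip Omega T v v) / 2.
Proof.
by move=> /is_xgrad_xgrad[u2 _] /is_xgrad_xgrad[v2 _]; exact: (field_ip_le u2 v2).
Qed.

End spatial_gradients.

Lemma eq_within_itv (R : realType) (a b : R) (f g : R -> R) : a < b ->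
  {within `[a, b], continuous f} -> {within `[a, b], continuous g} ->
  (forall s, a < s < b -> f s = g s) -> forall s, a <= s <= b -> f s = g s.
Proof.
move=> ab /(continuous_within_itvP _ ab)[_ fa fb] /(continuous_within_itvP _ ab)[_ ga gb] fg s.
rewrite !le_eqVlt => /andP[/predU1P[<- _|as_ /predU1P[->|sb]]]; last by rewrite fg// as_.
- suff fga : f y @[y --> a^'+] --> g a by exact: (cvg_unique _ fa fga).
  apply: cvg_trans ga; apply: near_eq_cvg; near=> y; rewrite fg//.
  by apply/andP; split; near: y; [exact: nbhs_right_gt|exact: nbhs_right_lt].
- suff fgb : f y @[y --> b^'-] --> g b by exact: (cvg_unique _ fb fgb).
  apply: cvg_trans gb; apply: near_eq_cvg; near=> y; rewrite fg//.
  by apply/andP; split; near: y; [exact: nbhs_left_gt|exact: nbhs_left_lt].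
Unshelve. all: by end_near. Qed.

Section space_time_polynomials.
Context {R : realType} {d : nat}.
Variables (Omega : set 'rV[R]_d) (T : R) (Th : seq 'M[R]_(d.+1, d)) (p N : nat) (t : nat -> R).
Local Notation XT := ('rV[R]_d * measurableTypeR R)%type.
Local Notation Q := (QT Omega T : set XT).
Local Notation mu := (leb_xt d : set XT -> \bar R).
Local Notation slabsN := (slabs N t).
Hypothesis tp : time_partition T N t.
Implicit Types (u v : XT -> R) (U V : nat -> 'rV[R]_d -> {poly R})
  (G H : nat -> 'I_d -> 'rV[R]_d -> {poly R}).

Definition slabwise u U : Prop := forall n x s, (n < N)%N -> Omega x -> t n < s < t n.+1 ->
  u (x, s) = (U n x).[s].

Definition Vh_polys m U G : Prop := forall n, (n < N)%N -> Vh_poly Omega Th p m (U n) (G n).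

Definition zero_outside U : Prop := forall n x, (n < N)%N -> ~ Omega x -> U n x = 0.

Definition slabs_field G (z : XT) : 'rV[R]_d := \row_i slabsN (fun n => G n i) z.

Let t_incr n : (n < N)%N -> t n < t n.+1. Proof. by have [_ _] := tp; apply. Qed.

Lemma slabs_slabwise U : slabwise (slabsN U) U.
Proof. by move=> n x s nN Ox sn; rewrite (slabsE t_incr _ _ nN sn). Qed.

Lemma slabs_eq0_outside U z : zero_outside U -> ~ Q z -> slabsN U z = 0.
Proof.
case: z => x s U0 Qz.
have [[n nN sn]|ns] := pselect (exists2 n, (n < N)%N & t n < s < t n.+1); last first.
  exact: slabs_eq0.
rewrite (slabsE t_incr _ _ nN sn) U0 ?horner0// => Ox; apply: Qz; split => //=.
by have [<- <- _] := tp; rewrite in_itv/=; exact: (partition_strict_bounds t_incr nN sn).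
Qed.

Lemma slabs_restrict U : zero_outside U -> slabsN U \_ Q = slabsN U.
Proof.
move=> U0; apply/funext => z; rewrite patchE; case: ifPn => // /negP zQ.
by rewrite slabs_eq0_outside// => /mem_set.
Qed.

(* The values of [u] at the nodes do not matter, since [slabsN V] vanishes there. *)
Lemma L2ip_slabs u U V : slabwise u U -> zero_outside V ->
  L2ip mu Q u (slabsN V) = \int[mu]_z (slabsN U z * slabsN V z).
Proof.
move=> uU V0; rewrite /L2ip Rintegral_mkcond; apply: eq_Rintegral => -[x s] _.
rewrite patchE; case: ifPn => [/set_mem[Ox _]|/negP xsQ]; last first.
  by rewrite [slabsN V _]slabs_eq0_outside ?mulr0// => /mem_set.
have [[n nN sn]|ns] := pselect (exists2 n, (n < N)%N & t n < s < t n.+1).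
  by rewrite (uU n)// !(slabsE t_incr _ _ nN sn).
by rewrite [slabsN V _]slabs_eq0// !mulr0.
Qed.

Section Vh_polys.
Variables (m : nat) (U : nat -> 'rV[R]_d -> {poly R}) (G : nat -> 'I_d -> 'rV[R]_d -> {poly R}).
Hypothesis UG : Vh_polys m U G.

Lemma Vh_polys_zero_outside : zero_outside U.
Proof. by move=> n x nN; exact: Vh_poly_eq0 (UG nN). Qed.

Lemma Vh_polys_grad_zero_outside i : zero_outside (fun n => G n i).
Proof. by move=> n x nN; exact: Vh_poly_grad_eq0 (UG nN). Qed.

Lemma slabs_field_coord i :
  (fun z => slabs_field G z ord0 i) \_ Q = slabsN (fun n => G n i).
Proof.
rewrite -(slabs_restrict (Vh_polys_grad_zero_outside i)).
by congr (_ \_ _); apply/funext => z; rewrite mxE.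
Qed.

Lemma slabs_field_L2 : L2_field mu Q (slabs_field G).
Proof.
move=> i; rewrite /L2/= slabs_field_coord; apply: (@slabs_Lfun2 _ _ _ _ _ _ m) => n nN.
exact: Vh_poly_grad_L2 (UG nN).
Qed.

Lemma slabwise_is_xgrad u : slabwise u U -> is_xgrad Omega T u (slabs_field G).
Proof.
move=> uU; split; first exact: slabs_field_L2.
exists (nodes N t); split; [exact: measurable_nodes|exact: lebesgue_measure_nodes|].
move=> s /=; apply: contra_notP => ns sT.
have [n nN sn] : exists2 n, (n < N)%N & t n < s < t n.+1.
  by apply: slab_index => //; have [-> -> _] := tp.
apply: is_weak_grad_ext (Vh_poly_horner s (UG nN)) => x Ox; first by rewrite (uU n).
by apply/rowP => i; rewrite /slabs_field !mxE (slabsE t_incr _ _ nN sn).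
Qed.

Lemma Vh_polys_linear m' (M : nat -> {linear {poly R} -> {poly R}}) :
  (forall n (r : {poly R}), (n < N)%N -> (size r <= m)%N -> (size (M n r) <= m')%N) ->
  Vh_polys m' (fun n => M n \o U n) (fun n i => M n \o G n i).
Proof.
by move=> sM n nN; apply: Vh_poly_linear (UG nN) => r; exact: sM.
Qed.

End Vh_polys.

Lemma field_ip_slabs m m' U V G H : Vh_polys m U G -> Vh_polys m' V H ->
  field_ip mu Q (slabs_field G) (slabs_field H) =
  \sum_i \sum_(n < N) slab_ip (leb d) (t n) (t n.+1) (G n i) (H n i).
Proof.
move=> UG VH; rewrite (field_ip_sum (slabs_field_L2 UG) (slabs_field_L2 VH)).
apply: eq_bigr => i _.
rewrite L2ip_restrict (slabs_field_coord UG) (slabs_field_coord VH).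
apply: (Rintegral_slabs_mul (m := m) (m' := m') t_incr) => n nN.
  exact: Vh_poly_grad_L2 (UG n nN).
exact: Vh_poly_grad_L2 (VH n nN).
Qed.

Lemma slabs_Vdisc m U G : Vh_polys m.+1 U G -> Vdisc Omega T N t (Vh Omega Th p) m (slabsN U).
Proof.
move=> UG; split.
  apply: (@measurable_funS _ _ _ _ setT) => //; apply: (@Lfun2_measurable _ _ _ mu).
  by apply: (@slabs_Lfun2 _ _ _ _ _ _ m.+1) => n nN; exact: Vh_poly_L2 (UG n nN).
move=> n nN; have [w [g [wV _ UE _]]] := UG n nN; exists w => // x s Ox sn.
rewrite (slabsE t_incr _ _ nN sn)// UE horner_poly; apply: eq_bigr => k _.
by rewrite patchE mem_set// mulrC.
Qed.

Lemma Vdisc_Vh_polys m u : Vdisc Omega T N t (Vh Omega Th p) m u ->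
  exists U G, Vh_polys m.+1 U G /\ slabwise u U.
Proof.
move=> [_ uV].
have /choice[w wP] n : exists w : nat -> 'rV[R]_d -> R, (n < N)%N ->
    (forall k, Vh Omega Th p (w k)) /\
    forall x s, Omega x -> t n < s < t n.+1 -> u (x, s) = \sum_(k < m.+1) s ^+ k * w k x.
  case: (boolP (n < N)%N) => nN; last by exists (fun _ _ => 0).
  by have [w wV wE] := uV n nN; exists w.
have /choice[G GP] n : exists G : 'I_d -> 'rV[R]_d -> {poly R}, (n < N)%N ->
    Vh_poly Omega Th p m.+1 (fun x => \poly_(k < m.+1) (w n k \_ Omega) x) G.
  case: (boolP (n < N)%N) => nN; last by exists (fun _ _ => 0).
  by have [wV _] := wP n nN; have [G GP] := Vh_poly_exists m.+1 wV; exists G.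
exists (fun n x => \poly_(k < m.+1) (w n k \_ Omega) x), G; split => //.
move=> n x s nN Ox sn; have [_ ->//] := wP n nN.
by rewrite horner_poly; apply: eq_bigr => k _; rewrite patchE mem_set// mulrC.
Qed.

Lemma dt_slabwise u U : slabwise u U -> slabwise (dt u) (fun n x => (U n x)^`()).
Proof.
move=> uU n x s nN Ox sn; rewrite /dt/= derive1E.
have [_ <-] := is_derive_poly (U n x) s.
apply: near_eq_derive.
have : nbhs s (`]t n, t n.+1[%classic : set R).
  by apply: open_nbhs_nbhs; split; [exact: interval_open|rewrite /= in_itv].
by apply: filterS => y; rewrite /= in_itv/= => yn; rewrite (uU n).
Qed.

Lemma poly_proj_pproj (a b : R) m (r : {poly R}) (g : R -> R) : a < b ->
  (forall s, a < s < b -> g s = r.[s]) -> poly_proj a b m g = pproj a b m.+1 r.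
Proof.
move=> ab gE.
have ipE (f : R -> R) (P S : {poly R}) : (forall s, a < s < b -> f s = P.[s]) ->
    L2ip (@lebesgue_measure R) `]a, b[ f (horner S) = pint a b (P * S).
  move=> fE; apply: eq_Rintegral => s; rewrite inE/= in_itv/= => sab.
  by rewrite fE// hornerM.
rewrite /poly_proj; case: xgetP => [P _ [sP PP]|].
  by apply: pproj_unique => // S sS; have := PP _ sS; rewrite (ipE _ P)// (ipE _ r).
move=> /(_ (pproj a b m.+1 r)) []; split; first exact: size_pproj.
by move=> S sS; rewrite (ipE _ (pproj a b m.+1 r))// (ipE _ r)// pint_pproj.
Qed.

Lemma time_proj_slabwise m u U : slabwise u U ->
  slabwise (time_proj N t m u) (fun n => pproj (t n) (t n.+1) m.+1 \o U n).
Proof.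
move=> uU n x s nN Ox sn; rewrite /time_proj/= (bigD1 (Ordinal nN))//= big1.
  rewrite addr0 (@poly_proj_pproj _ _ _ (U n x))//; first exact: t_incr.
  by move=> y yn; exact: uU.
move=> j /andP[sj /eqP jn]; case: jn; apply/val_inj.
exact: (partition_uniq t_incr) sj sn.
Qed.

Lemma slabwise_closed u U : slabwise u U ->
  (forall x, Omega x -> {within `[0, T], continuous (fun s => u (x, s))}) ->
  forall n x s, (n < N)%N -> Omega x -> t n <= s <= t n.+1 -> u (x, s) = (U n x).[s].
Proof.
move=> uU cu n x s nN Ox.
apply: (eq_within_itv (f := fun y => u (x, y)) (g := horner (U n x)) (t_incr nN)).
- apply: continuous_subspaceW (cu x Ox) => y /=; rewrite !in_itv/=.
  by have [<- <- _] := tp; exact: (partition_bounds t_incr nN).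
- by apply: continuous_subspaceT => y; exact: continuous_horner.
- by move=> y yn; exact: uU.
Qed.

End space_time_polynomials.

Section L1L2_duality.
Context d (X : measurableType d) (R : realType).
Variable mu : {sigma_finite_measure set X -> \bar R}.
Local Notation lambda := (@lebesgue_measure R).
Local Notation XR := (X * measurableTypeR R)%type.
Implicit Types f v : XR -> R.

Lemma measurable_Lnorm2_section f : measurable_fun setT f ->
  measurable_fun [set: measurableTypeR R]
    (fun s => 'N[mu]_2%:E[EFin \o (fun x => f (x, s))])%E.
Proof.
move=> mf; rewrite unlock; apply: (measurableT_comp (measurable_poweR _)).
apply: (measurable_fun_fubini_tonelli_G (fun z : XR => (`|(f z)%:E| `^ 2)%E)) => [|z].
  apply: (measurableT_comp (measurable_poweR _)).
  by apply: measurableT_comp => //; exact/measurable_EFinP.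
exact: poweR_ge0.
Qed.

Lemma Rintegral_mul_le_L1L2 f v (b : R) : 0 <= b ->
  f \in Lfun (mu \x lambda)%E 2%:E -> v \in Lfun (mu \x lambda)%E 2%:E ->
  (forall s, 'N[mu]_2%:E[EFin \o (fun x => v (x, s))] <= b%:E)%E ->
  ((\int[(mu \x lambda)%E]_z (f z * v z))%:E <=
   b%:E * \int[lambda]_s 'N[mu]_2%:E[EFin \o (fun x => f (x, s))])%E.
Proof.
move=> b0 f2 v2 vb; have ifv := Lfun2_mul_integrable f2 v2.
have mf := Lfun2_measurable f2; have mv := Lfun2_measurable v2.
have mfv : measurable_fun setT (fun z => (f z * v z)%:E) by exact: measurable_int ifv.
have mabs : measurable_fun setT (fun z => `|(f z * v z)%:E|%E) by exact: measurableT_comp.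
rewrite /Rintegral fineK; last exact: integrable_fin_num.
apply: (le_trans (lee_abs _)); apply: (le_trans (le_abse_integral _ measurableT mfv)).
rewrite (fubini_tonelli2 (fun z => `|(f z * v z)%:E|%E)) //.
have mN := measurable_Lnorm2_section mf.
rewrite -ge0_integralZl//; last by move=> s _; exact: Lnorm_ge0.
apply: ge0_le_integral => //.
- by move=> s _; apply: integral_ge0.
- exact: (measurable_fun_fubini_tonelli_G (fun z => `|(f z * v z)%:E|%E)).
- exact: measurable_funeM.
move=> s _; rewrite /fubini_G.
rewrite -(Lnorm1 mu (EFin \o ((fun x => f (x, s)) \* (fun x => v (x, s))))).
apply: (le_trans (@hoelder _ _ _ mu _ _ 2 2 _ _ _ _ _)) => //.
- exact: (measurableT_comp mf (pair2_measurable _)).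
- exact: (measurableT_comp mv (pair2_measurable _)).
- by field.
by rewrite muleC; apply: lee_wpmul2r => //; exact: Lnorm_ge0.
Qed.

End L1L2_duality.

Lemma sqre_le_sqrt (R : realType) (b : R) (x : \bar R) : 0 <= b -> (0 <= x)%E ->
  (x ^+ 2 <= b%:E)%E = (x <= (Num.sqrt b)%:E)%E.
Proof.
move=> b0; case: x => [r| |]//; rewrite -?EFin_expe ?mulyy// !lee_fin => r0.
by rewrite -[in LHS](sqr_sqrtr b0) ler_pXn2r// ?nnegrE// sqrtr_ge0.
Qed.

Section space_time_norms.
Context {R : realType} {d : nat}.
Variables (Omega : set 'rV[R]_d) (T : R).
Local Notation XT := ('rV[R]_d * measurableTypeR R)%type.
Local Notation Q := (QT Omega T : set XT).
Implicit Types f v : XT -> R.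

Lemma norm_L1L2_restrict f : (norm_L1L2 Omega T f =
  \int[lebesgue_measure]_s 'N[leb d]_2%:E[EFin \o (fun x => (f \_ Q) (x, s))])%E.
Proof.
rewrite /norm_L1L2 integral_mkcond; apply: eq_integral => s _; rewrite patchE.
case: ifPn => [/set_mem sT|/negP sT].
  rewrite /L2norm; congr (Lnorm _ _ (EFin \o _)); apply/funext => x; rewrite !patchE.
  have [xO|xO] := boolP (x \in Omega); first by rewrite mem_set//; split => //; exact: set_mem.
  by rewrite memNset// => -[/= /mem_set Ox _]; rewrite Ox in xO.
have -> : EFin \o (fun x => (f \_ Q) (x, s)) = cst 0%E.
  by apply/funext => x /=; rewrite patchE memNset// => -[_ /= /mem_set].
by rewrite Lnorm0.
Qed.

Lemma norm_L1L2_ge0 f : (0 <= norm_L1L2 Omega T f)%E.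
Proof. by apply: integral_ge0 => s _; exact: Lnorm_ge0. Qed.

Lemma L2ip_le_L1L2 f v (b : R) : 0 <= b -> L2 (leb_xt d) Q f -> v \in Lfun (leb_xt d) 2%:E ->
  (forall s, 'N[leb d]_2%:E[EFin \o (fun x => v (x, s))] <= b%:E)%E ->
  ((L2ip (leb_xt d) Q f v)%:E <= b%:E * norm_L1L2 Omega T f)%E.
Proof.
by move=> b0 f2 v2 vb; rewrite L2ip_restrictl norm_L1L2_restrict; exact: Rintegral_mul_le_L1L2.
Qed.

Lemma norm_C0L2_sqr_le f (b : R) : 0 <= T -> 0 <= b ->
  (forall s, 0 <= s <= T -> (L2norm (leb d) Omega (fun x => f (x, s)) ^+ 2 <= b%:E)%E) ->
  (norm_C0L2 Omega T f ^+ 2 <= b%:E)%E.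
Proof.
move=> T0 b0 fb; have sup_ge0 : (0 <= norm_C0L2 Omega T f)%E.
  apply: (@le_trans _ _ (L2norm (leb d) Omega (fun x => f (x, 0)))); first exact: Lnorm_ge0.
  by apply: ereal_sup_ubound; exists 0 => //=; rewrite in_itv/= lexx.
rewrite sqre_le_sqrt//; apply: ge_ereal_sup => _ [s /= + <-]; rewrite in_itv/= => sT.
by rewrite -sqre_le_sqrt ?Lnorm_ge0// fb.
Qed.

End space_time_norms.

Lemma sqrt_absorption (R : rcfType) (K F a J : R) : 0 < K -> 0 <= J ->
  J <= a + 2 * (Num.sqrt (K * J) * F) ->
  a + 2 * (Num.sqrt (K * J) * F) <= 2 * a + 4 * K * F ^+ 2.
Proof.
move=> K0 J0 Ja; have : 4 * (Num.sqrt (K * J) * F) <= J + 4 * K * F ^+ 2.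
  have KJ0 : 0 <= K * J by rewrite mulr_ge0// ltW.
  rewrite -(ler_pM2l K0); have := sqr_sqrtr KJ0; set r := Num.sqrt _ => rE.
  have := sqr_ge0 (r - 2 * K * F); rewrite mulrDr -rE; nra.
lra.
Qed.

(* Here [q] is one less than the degree in time of [u]. *)
Section energy.
Context {R : realType} {d : nat}.
Variables (Omega : set 'rV[R]_d) (T : R) (Th : seq 'M[R]_(d.+1, d)) (p N : nat) (t : nat -> R).
Variables (q : nat) (nu K F : R) (f Ups u : 'rV[R]_d * measurableTypeR R -> R).
Variables (U : nat -> 'rV[R]_d -> {poly R}) (G : nat -> 'I_d -> 'rV[R]_d -> {poly R}).
Local Notation XT := ('rV[R]_d * measurableTypeR R)%type.
Local Notation Q := (QT Omega T : set XT).
Local Notation mu := (leb_xt d : set XT -> \bar R).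
Local Notation ip n := (slab_ip (leb d) (t n) (t n.+1)).
Implicit Types M : nat -> {linear {poly R} -> {poly R}}.

Hypotheses (oOmega : open Omega) (tp : time_partition T N t).
Hypotheses (UG : Vh_polys Omega Th p N q.+2 U G) (uU : slabwise Omega N t u U).

Let t_incr n : (n < N)%N -> t n < t n.+1. Proof. by have [_ _] := tp; apply. Qed.

Let U2 n : (n < N)%N -> L2poly (leb d) q.+2 (U n).
Proof. by move=> nN; exact: Vh_poly_L2 (UG nN). Qed.

Definition test_operator M : Prop := forall n r, (n < N)%N ->
  [/\ (size (M n r) <= q.+1)%N,
      pint (t n) (t n.+1) (M n r * M n r) <= pint (t n) (t n.+1) (r * r) &
      pint (t n) (t n.+1) (M n r * M n r) <= pint (t n) (t n.+1) (r * M n r)].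

Definition tested M : XT -> R := slabs N t (fun n => M n \o U n).

Definition proj_test n : {linear {poly R} -> {poly R}} := pproj (t n) (t n.+1) q.+1.

Definition slab_test k n : {linear {poly R} -> {poly R}} :=
  if (n < k)%N then proj_test n
  else if n == k then (wproj (t n) (t n.+1) q.+1 : {linear {poly R} -> {poly R}})
  else (\0%R : {linear {poly R} -> {poly R}}).

Lemma proj_test_operator : test_operator proj_test.
Proof.
move=> n r nN; have tn := t_incr nN.
by split; [exact: size_pproj|exact: pint_sqr_pproj|rewrite (pint_mul_pproj tn)].
Qed.

Lemma slab_test_operator k : test_operator (slab_test k).
Proof.
move=> n r nN; have tn := t_incr nN; rewrite /slab_test; case: ltnP => _.
  exact: proj_test_operator.
case: eqP => _.
  by split; [exact: size_pproj|exact: pint_sqr_wproj_le_sqr|exact: pint_sqr_wproj_le].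
by split; rewrite /= ?size_poly0// !mulr0 linear0// pint_sqr_ge0.
Qed.

Lemma test_operator_Vh_polys M : test_operator M ->
  Vh_polys Omega Th p N q.+1 (fun n => M n \o U n) (fun n i => M n \o G n i).
Proof. by move=> tM; apply: (Vh_polys_linear (M := M) UG) => n r nN _; have [] := tM n r nN. Qed.

Definition deriv_form M : R := \sum_(n < N) ip n (fun x => (U n x)^`()) (M n \o U n).

Lemma L2ip_dt_tested M : test_operator M -> L2ip mu Q (dt u) (tested M) = deriv_form M.
Proof.
move=> tM; have MUG := test_operator_Vh_polys tM.
rewrite (L2ip_slabs tp (dt_slabwise uU) (Vh_polys_zero_outside MUG)).
apply: (Rintegral_slabs_mul (m := q.+1) (m' := q.+1) t_incr) => n nN.
  exact: L2poly_deriv (U2 nN).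
exact: Vh_poly_L2 (MUG n nN).
Qed.

Lemma tested_is_xgrad M : test_operator M ->
  is_xgrad Omega T (tested M) (slabs_field N t (fun n i => M n \o G n i)).
Proof.
move=> tM; apply: (slabwise_is_xgrad tp (test_operator_Vh_polys tM)).
exact: (slabs_slabwise tp).
Qed.

Lemma xgrad_ip_tested_le M : test_operator M ->
  xgrad_ip Omega T (tested M) (tested M) <= xgrad_ip Omega T u (tested M).
Proof.
move=> tM; have MUG := test_operator_Vh_polys tM; have vH := tested_is_xgrad tM.
rewrite (xgrad_ipE oOmega vH vH) (xgrad_ipE oOmega (slabwise_is_xgrad tp UG uU) vH).
rewrite (field_ip_slabs tp MUG MUG) (field_ip_slabs tp UG MUG).
apply: ler_sum => i _; apply: ler_sum => n _; have nN := ltn_ord n.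
have G2 := Vh_poly_grad_L2 i (UG nN); have MG2 := Vh_poly_grad_L2 i (MUG n nN).
by apply: (le_slab_ip MG2 MG2 G2 MG2) => x; have [] := tM n (G n i x) nN.
Qed.

Lemma xgrad_norm_time_proj :
  (xgrad_norm Omega T (time_proj N t q u) ^+ 2 =
   (xgrad_ip Omega T (tested proj_test) (tested proj_test))%:E)%E.
Proof.
have tP := proj_test_operator; have vH := tested_is_xgrad tP.
have uP := slabwise_is_xgrad tp (test_operator_Vh_polys tP) (time_proj_slabwise tp q uU).
by rewrite (xgrad_norm_sqr uP) (xgrad_ipE oOmega uP uP) (xgrad_ipE oOmega vH vH).
Qed.

Definition slab_mean n : R := ip n (U n) (U n) / (t n.+1 - t n).

Hypotheses (K0 : 0 < K) (K_inverse : inverse_constant q.+2 K).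

Lemma Lnorm2_tested_le M J : test_operator M -> 0 <= J ->
  (forall n, (n < N)%N -> slab_mean n <= J) ->
  forall s, ('N[leb d]_2%:E[EFin \o (fun x => tested M (x, s))] <= (Num.sqrt (K * J))%:E)%E.
Proof.
move=> tM J0 mean_le.
have MU2 n : (n < N)%N -> L2poly (leb d) q.+2 (M n \o U n).
  by move=> nN; apply: L2poly_linear (U2 nN) => r _; have [/leqW] := tM n r nN.
apply: (Lnorm2_slabs_le t_incr MU2) => [|n s nN /andP[ns sn]]; first exact: sqrtr_ge0.
rewrite sqr_sqrtr; last by rewrite mulr_ge0// ltW.
have sn' : t n <= s <= t n.+1 by rewrite !ltW.
apply: le_trans (slab_inverse_estimate (t_incr nN) (MU2 n nN) K_inverse sn') _.
rewrite ler_pM2l//; apply: le_trans (mean_le n nN).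
apply: ler_wpM2r; first by rewrite invr_ge0 subr_ge0 ltW// t_incr.
apply: (le_slab_ip (MU2 n nN) (MU2 n nN) (U2 nN) (U2 nN)) => x.
by have [] := tM n (U n x) nN.
Qed.

Hypotheses (nu0 : 0 < nu) (f2 : L2 mu Q f) (FE : norm_L1L2 Omega T f = F%:E).
Hypothesis Ups_xgrad : exists Y, is_xgrad Omega T Ups Y.
Hypothesis scheme : forall v, Vdisc Omega T N t (Vh Omega Th p) q v ->
  L2ip mu Q (dt u) v + nu * xgrad_ip Omega T u v = L2ip mu Q f v + nu * xgrad_ip Omega T Ups v.

Lemma energy_estimate M J : test_operator M -> 0 <= J ->
  (forall n, (n < N)%N -> slab_mean n <= J) ->
  deriv_form M + nu * xgrad_ip Omega T (tested M) (tested M) / 2 <=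
  Num.sqrt (K * J) * F + nu * xgrad_ip Omega T Ups Ups / 2.
Proof.
move=> tM J0 mean_le; have MUG := test_operator_Vh_polys tM; have [Y UpsY] := Ups_xgrad.
have f_le : L2ip mu Q f (tested M) <= Num.sqrt (K * J) * F.
  rewrite -lee_fin EFinM -FE; apply: L2ip_le_L1L2; rewrite ?sqrtr_ge0//.
    by apply: (@slabs_Lfun2 _ _ _ _ _ _ q.+1) => n nN; exact: Vh_poly_L2 (MUG n nN).
  exact: Lnorm2_tested_le.
have Ups_le := ler_wpM2l (ltW nu0) (xgrad_ip_le UpsY (tested_is_xgrad tM)).
have u_ge := ler_wpM2l (ltW nu0) (xgrad_ip_tested_le tM).
move: f_le Ups_le u_ge (scheme (slabs_Vdisc tp MUG)); rewrite -/(tested M) (L2ip_dt_tested tM).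
move: (L2ip mu Q f _) (xgrad_ip Omega T u _) (xgrad_ip Omega T Ups (tested M)).
by move: (xgrad_ip Omega T _ _) (xgrad_ip Omega T Ups _) (deriv_form M) => *; lra.
Qed.

Hypothesis u_closed :
  forall n x s, (n < N)%N -> Omega x -> t n <= s <= t n.+1 -> u (x, s) = (U n x).[s].

Definition energy s : R := \int[leb d]_x (((fun x => u (x, s)) \_ Omega) x ^+ 2).

Lemma energy_ge0 s : 0 <= energy s.
Proof. by apply: Rintegral_ge0 => x _; exact: sqr_ge0. Qed.

Lemma restrict_section n s : (n < N)%N -> t n <= s <= t n.+1 ->
  (fun x => u (x, s)) \_ Omega = fun x => (U n x).[s].
Proof.
move=> nN sn; apply/funext => x; rewrite patchE; case: ifPn => [/set_mem Ox|/negP xO].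
  by rewrite (u_closed nN).
by rewrite (Vh_polys_zero_outside UG)// ?horner0// => /mem_set.
Qed.

Lemma section_L2 n s : (n < N)%N -> t n <= s <= t n.+1 -> L2 (leb d) Omega (fun x => u (x, s)).
Proof.
by move=> nN sn; rewrite /L2/= (restrict_section nN sn); exact: L2poly_horner (U2 nN).
Qed.

Lemma energyE n s : (n < N)%N -> t n <= s <= t n.+1 ->
  energy s = \int[leb d]_x ((U n x).[s] ^+ 2).
Proof. by move=> nN sn; rewrite /energy (restrict_section nN sn). Qed.

Lemma slab_ip_deriv_proj_test n : (n < N)%N ->
  ip n (fun x => (U n x)^`()) (proj_test n \o U n) = energy (t n.+1) / 2 - energy (t n) / 2.
Proof.
move=> nN; have tn := ltW (t_incr nN); rewrite -mulrBl !(energyE nN) ?lexx ?tn//.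
by rewrite -(slab_ip_deriv_pproj (t_incr nN) (U2 nN)).
Qed.

Lemma energy_le_slab_mean n s : (n < N)%N -> t n <= s <= t n.+1 -> energy s <= K * slab_mean n.
Proof.
move=> nN sn; rewrite (energyE nN sn).
exact: (slab_inverse_estimate (t_incr nN) (U2 nN) K_inverse sn).
Qed.

Lemma slab_mean_le_deriv k : (k < N)%N ->
  (slab_mean k - energy (t 0)) / 2 <= deriv_form (slab_test k).
Proof.
move=> kN; pose D n := ip n (fun x => (U n x)^`()) (slab_test k n \o U n).
rewrite /deriv_form -(big_mkord xpredT D) (big_cat_nat (n := k)) ?(ltnW kN)//= (big_ltn kN).
have -> : \sum_(0 <= n < k) D n = energy (t k) / 2 - energy (t 0) / 2.
  apply: (telescope_sumr_eq (fun n => energy (t n) / 2)) => // n /andP[_ nk].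
  by rewrite /D /slab_test nk slab_ip_deriv_proj_test// (ltn_trans nk).
have -> : \sum_(k.+1 <= n < N) D n = 0.
  rewrite big_nat big1// => n /andP[kn _].
  rewrite /D /slab_test ltnNge (ltnW kn)/= gtn_eqF//.
  by rewrite /slab_ip; under eq_Rintegral do rewrite /= mulr0 linear0; rewrite Rintegral_cst ?mul0r.
have tk := ltW (t_incr kN).
have := slab_ip_deriv_wproj_ge (t_incr kN) (U2 kN).
rewrite -(energyE kN) ?lexx ?tk// -/(slab_mean k) /D /slab_test ltnn eqxx; lra.
Qed.

Lemma deriv_form_proj_test : deriv_form proj_test = energy (t N) / 2 - energy (t 0) / 2.
Proof.
rewrite -(telescope_sumr (fun n => energy (t n) / 2))// big_mkord.
by apply: eq_bigr => n _; exact: slab_ip_deriv_proj_test.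
Qed.

Definition mean_bound (J : R) : R :=
  energy (t 0) + nu * xgrad_ip Omega T Ups Ups + 2 * (Num.sqrt (K * J) * F).

Section bounded_means.
Variable J : R.
Hypotheses (J0 : 0 <= J) (mean_le : forall n, (n < N)%N -> slab_mean n <= J).

Lemma gradient_le : nu * xgrad_ip Omega T (tested proj_test) (tested proj_test) <= mean_bound J.
Proof.
have := energy_estimate proj_test_operator J0 mean_le; rewrite deriv_form_proj_test /mean_bound.
move: (xgrad_ip Omega T (tested _) _) (xgrad_ip Omega T Ups Ups) (energy_ge0 (t N)).
by move: (energy (t N)) (energy (t 0)) => *; lra.
Qed.

Lemma slab_mean_le k : (k < N)%N -> slab_mean k <= mean_bound J.
Proof.
move=> kN; have := mulr_ge0 (ltW nu0) (xgrad_ip_sqr_ge0 Omega T (tested (slab_test k))).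
move: (slab_mean_le_deriv kN) (energy_estimate (slab_test_operator k) J0 mean_le).
rewrite /mean_bound; move: (xgrad_ip Omega T (tested _) _) (xgrad_ip Omega T Ups _) (deriv_form _).
by move: (slab_mean k) (energy (t 0)) => *; lra.
Qed.

End bounded_means.

Definition data_bound : R :=
  2 * (energy 0 + nu * xgrad_ip Omega T Ups Ups) + 4 * K * F ^+ 2.

Lemma energy_stability :
  (forall n s, (n < N)%N -> t n <= s <= t n.+1 -> energy s <= K * data_bound) /\
  nu * xgrad_ip Omega T (tested proj_test) (tested proj_test) <= data_bound.
Proof.
pose J := \big[Num.max/0]_(n < N) slab_mean n.
have J0 : 0 <= J by exact: bigmax_ge_id.
have mean_le n : (n < N)%N -> slab_mean n <= J.
  by move=> nN; exact: (le_bigmax 0 (fun i : 'I_N => slab_mean i) (Ordinal nN)).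
have F0 : 0 <= F by rewrite -lee_fin -FE norm_L1L2_ge0.
have grad_ge0 := mulr_ge0 (ltW nu0) (xgrad_ip_sqr_ge0 Omega T Ups).
have J_bound : J <= mean_bound J.
  apply: bigmax_le => [|n _]; last exact: slab_mean_le.
  by rewrite !addr_ge0 ?energy_ge0// !mulr_ge0// sqrtr_ge0.
have bound_data : mean_bound J <= data_bound.
  by have [t0 _ _] := tp; rewrite /data_bound -t0; exact: sqrt_absorption.
split=> [n s nN sn|]; last exact: le_trans (gradient_le J0 mean_le) bound_data.
apply: le_trans (energy_le_slab_mean nN sn) _.
by rewrite ler_pM2l// (le_trans (mean_le n nN))// (le_trans J_bound).
Qed.

Lemma norm_C0L2_stability : 0 < T -> (norm_C0L2 Omega T u ^+ 2 <= (K * data_bound)%:E)%E.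
Proof.
move=> T0; have [t0 tN _] := tp; have [e_le grad_le] := energy_stability.
have N0 : (0 < N)%N by rewrite lt0n; apply/eqP => N0; move: T0; rewrite -tN N0 t0 ltxx.
apply: norm_C0L2_sqr_le; first exact: ltW.
  rewrite mulr_ge0 ?(ltW K0)//; apply: le_trans grad_le.
  by rewrite mulr_ge0 ?(ltW nu0)// xgrad_ip_sqr_ge0.
rewrite -{1}t0 -tN => s sT; have [n nN sn] := closed_slab_index N0 sT.
by rewrite (L2norm_sqr (section_L2 nN sn)) lee_fin -/(energy s) (e_le n).
Qed.

Lemma stability_estimate : 0 < T ->
  (norm_C0L2 Omega T u ^+ 2 + nu%:E * xgrad_norm Omega T (time_proj N t q u) ^+ 2 <=
   ((K + 1) * data_bound)%:E)%E.
Proof.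
move=> T0; rewrite mulrDl mul1r EFinD; apply: leeD; first exact: norm_C0L2_stability.
by rewrite xgrad_norm_time_proj -EFinM lee_fin; have [_ +] := energy_stability.
Qed.

End energy.

Theorem proposition5p2 (R : realType) (q : nat) (hq : (1 <= q)%N) :
  exists2 C : R, 0 < C &
  forall (d : nat) (Omega : set 'rV[R]_d) (T : R)
    (Th : seq 'M[R]_(d.+1, d)) (gamma : R) (p : nat)
    (N : nat) (t : nat -> R) (nu : R)
    (f : 'rV[R]_d * R -> R) (u0 : 'rV[R]_d -> R)
    (Upsilon u : 'rV[R]_d * R -> R),
  (1 <= d <= 3)%N ->
  polytopic_domain Omega ->
  0 < T ->
  conforming_mesh Omega Th ->
  shape_regular gamma Th ->
  (1 <= p)%N ->
  time_partition T N t ->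
  0 < nu ->
  L2 (leb_xt d) (QT Omega T) f ->
  L2 (leb d) Omega u0 ->
  L2H1 Omega T Upsilon ->
  Vcont Omega T N t (Vh Omega Th p) q u ->
  is_L2proj (leb d) Omega (Vh Omega Th p) u0 (fun x => u (x, 0)) ->
  (forall v, Vdisc Omega T N t (Vh Omega Th p) q.-1 v ->
     L2ip (leb_xt d) (QT Omega T) (dt u) v + nu * xgrad_ip Omega T u v =
     L2ip (leb_xt d) (QT Omega T) f v + nu * xgrad_ip Omega T Upsilon v) ->
  (norm_C0L2 Omega T u ^+ 2 +
     nu%:E * xgrad_norm Omega T (time_proj N t q.-1 u) ^+ 2 <=
   C%:E * (L2norm (leb d) Omega u0 ^+ 2 + norm_L1L2 Omega T f ^+ 2 +
     nu%:E * xgrad_norm Omega T Upsilon ^+ 2))%E.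
Proof.
case: q hq => // q _; have [K K0 K_inverse] := inverse_estimate (R := R) q.+2.
have C0 : 0 < (K + 1) * (4 * K + 2) by rewrite mulr_gt0 ?addr_gt0// mulr_gt0.
exists ((K + 1) * (4 * K + 2)) => // d Omega T Th gamma p N t nu f u0 Upsilon u _.
move=> [_ _ [Ps OmegaE]] T0 _ _ _ tp nu0 f2 u02 [_ Ups_xgrad] [uV cu] u0_proj scheme.
have oOmega : open Omega by rewrite OmegaE; exact: open_interior.
have [U [G [UG uU]]] := Vdisc_Vh_polys uV.
have u_closed := slabwise_closed tp uU cu.
have u_0_L2 : L2 (leb d) Omega (fun x => u (x, 0)) by have [[[g []]]] := u0_proj.
have initial_le : energy Omega u 0 <= _ := L2proj_norm_le u02 u_0_L2 u0_proj.
have [Y UpsY] := Ups_xgrad.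
rewrite (L2norm_sqr u02) [X in (_ <= _ * (_ + _ * X))%E](xgrad_norm_sqr UpsY).
have := norm_L1L2_ge0 Omega T f; case FE : (norm_L1L2 Omega T f) => [F| |]// F0; last first.
  by rewrite [X in (_ <= _ * (_ + X + _))%E]mulyy addey// addye// gt0_muley ?leey// lte_fin.
apply: le_trans (stability_estimate oOmega tp UG uU K0 K_inverse nu0 f2 FE Ups_xgrad scheme
  u_closed T0) _.
rewrite -EFin_expe -!(EFinD, EFinM) lee_fin -mulrA ler_pM2l ?addr_gt0// /data_bound.
have := mulr_ge0 (ltW nu0) (xgrad_ip_sqr_ge0 Omega T Upsilon).
move: initial_le (energy_ge0 Omega u 0).
move: (energy _ _ _) (\int[_]_x _) (xgrad_ip _ _ _ _) => E I Y2 E_le E_ge0 Y2_ge0; nra.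
Qed.
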